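(* Let $n\le p$, $1<p<\infty$. If $f\in W^{1,p}(\mathbb{R}^n)\cap C(\mathbb{R}^n)$ is bounded below, and is a weak subsolution of the $p$-Laplace equation $\operatorname{div}(|\nabla f|^{p-2}\nabla f)=0$ on $\mathbb{R}^n$ with constant $p$-tension field, i.e. $\operatorname{div}(|\nabla f|^{p-2}\nabla f)=c$ weakly for some constant $c$, then $f$ is constant.
   Context: $f$ is a weak subsolution of the $p$-Laplace equation on $\mathbb{R}^n$ if $\int_{\mathbb{R}^n}|\nabla f|^{p-2}\nabla f\cdot\nabla\psi\,dx\le0$ for every nonnegative $\psi\in C_0^\infty(\mathbb{R}^n)$. It has constant $p$-tension field $c\in\mathbb{R}$ if $\int_{\mathbb{R}^n}|\nabla f|^{p-2}\nabla f\cdot\nabla\psi\,dx=-c\int_{\mathbb{R}^n}\psi\,dx$ for every $\psi\in C_0^\infty(\mathbb{R}^n)$. *)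

(* Defs.v *)
From HB Require Import structures.
From mathcomp Require Import all_boot all_order all_algebra.
From mathcomp Require Import all_classical all_reals all_analysis.

Set Implicit Arguments.
Unset Strict Implicit.
Unset Printing Implicit Defensive.

Import Order.TTheory GRing.Theory Num.Theory.
Import numFieldNormedType.Exports.

Local Open Scope classical_set_scope.
Local Open Scope ring_scope.

(* R^n is the normed space 'rV[R]_n, given the product sigma-algebra of the
   Borel sets of R, i.e. the Borel sigma-algebra of R^n. *)
Section measurable_rV.
Context {R : realType} (n : nat).

Definition rV_coord (i : 'I_n) (x : 'rV[R]_n) : measurableTypeR R := x ord0 i.

HB.instance Definition _ := @isMeasurable.Build default_measure_display
  'rV[R]_n (g_sigma_preimage rV_coord) (@sigma_algebra0 _ setT _)
  (@sigma_algebraC _ _) (@sigma_algebra_bigcup _ setT _).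

Lemma measurable_rV_coord (i : 'I_n) : measurable_fun setT (rV_coord i).
Proof.
move=> _ Y mY; rewrite setTI; apply: sub_sigma_algebra => /=.
rewrite -bigcup_seq/=; exists i => /=; first by rewrite mem_index_enum.
by exists Y => //; rewrite setTI.
Qed.

Lemma measurable_fun_rVP d (T : measurableType d) (f : T -> 'rV[R]_n) :
  (forall i, measurable_fun setT (rV_coord i \o f)) -> measurable_fun setT f.
Proof.
move=> mf _ A mA; rewrite setTI.
have sub : g_sigma_preimage rV_coord `<=` [set A | measurable (f @^-1` A)].
  apply: smallest_sub.
    split => /=.
    - by rewrite preimage_set0.
    - by move=> B mB; rewrite setTD preimage_setC; exact: measurableC.
    - by move=> F mF; rewrite preimage_bigcup; exact: bigcup_measurable.
  move=> B; rewrite -bigcup_seq/= => -[i _ [C mC <-]].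
  by rewrite setTI -comp_preimage -[X in measurable X]setTI; exact: mf.
exact: sub.
Qed.

End measurable_rV.

Section lebesgue_rV.
Context {R : realType}.

Definition rV_cons (n : nat) (x : measurableTypeR R * 'rV[R]_n) : 'rV[R]_n.+1 :=
  \row_(i < n.+1) oapp (x.2 ord0) x.1 (unlift ord0 i).

Lemma measurable_rV_cons n : measurable_fun setT (@rV_cons n).
Proof.
apply: measurable_fun_rVP => i.
case: (unliftP ord0 i) => [j ->|->].
- rewrite (_ : _ \o _ = rV_coord j \o snd); last first.
    by apply/funext => x; rewrite /= /rV_coord mxE liftK.
  exact: (measurableT_comp (measurable_rV_coord j) measurable_snd).
- rewrite (_ : _ \o _ = fst)//.
  by apply/funext => x; rewrite /= /rV_coord mxE unlift_none.
Qed.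

(* Product measures are only declared sigma-finite in the library for
   (sub)probability factors. *)
Lemma sigma_finite_prod d1 d2 (T1 : measurableType d1) (T2 : measurableType d2)
    (m1 : {sigma_finite_measure set T1 -> \bar R})
    (m2 : {sigma_finite_measure set T2 -> \bar R}) :
  sigma_finite setT (m1 \x m2)%E.
Proof.
have /sigma_finiteP[F [TF ndF Foo]] := sigma_finiteT m1.
have /sigma_finiteP[G [TG ndG Goo]] := sigma_finiteT m2.
exists (fun k => F k `*` G k).
  rewrite -setXTT TF TG predeqE => -[x y]; split; last first.
    by move=> [k _ []/= ? ?]; split; exists k.
  move=> [/= [k _ Fkx] [l _ Gly]]; exists (maxn k l) => //; split.
  - by move: x Fkx; exact/subsetPset/ndF/leq_maxl.
  - by move: y Gly; exact/subsetPset/ndG/leq_maxr.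
move=> k; have [? ?] := Foo k; have [? ?] := Goo k.
split; first exact: measurableX.
by rewrite product_measure1E// lte_mul_pinfty// ge0_fin_numE.
Qed.

Section step.
Variables (n : nat) (mu : {sigma_finite_measure set 'rV[R]_n -> \bar R}).

Definition lebesgue_rV_step : set 'rV[R]_n.+1 -> \bar R :=
  pushforward (lebesgue_measure \x mu)%E (@rV_cons n).

Let step0 : lebesgue_rV_step set0 = 0%E.
Proof. by rewrite /lebesgue_rV_step /pushforward preimage_set0 measure0. Qed.

Let step_ge0 A : (0 <= lebesgue_rV_step A)%E.
Proof. by rewrite /lebesgue_rV_step /pushforward measure_ge0. Qed.

Let measurable_preimage (A : set 'rV[R]_n.+1) :
  measurable A -> measurable (@rV_cons n @^-1` A).
Proof. by move=> mA; rewrite -[X in measurable X]setTI; exact: measurable_rV_cons. Qed.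

Let step_sigma_additive : semi_sigma_additive lebesgue_rV_step.
Proof.
move=> F mF tF mUF; rewrite /lebesgue_rV_step /pushforward preimage_bigcup.
apply: measure_semi_sigma_additive.
- by move=> i; exact: measurable_preimage.
- apply/trivIsetP => /= i j _ _ ij; rewrite -preimage_setI.
  by move/trivIsetP : tF => /(_ _ _ _ _ ij) ->//; rewrite preimage_set0.
- by rewrite -preimage_bigcup; exact: measurable_preimage.
Qed.

HB.instance Definition _ := isMeasure.Build _ _ _ lebesgue_rV_step
  step0 step_ge0 step_sigma_additive.

Let rV_uncons (x : 'rV[R]_n.+1) : measurableTypeR R * 'rV[R]_n :=
  (rV_coord ord0 x, \row_(i < n) x ord0 (lift ord0 i)).

Let measurable_rV_uncons : measurable_fun setT rV_uncons.
Proof.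
apply/measurable_fun_pairP; split.
  by rewrite (_ : _ \o _ = rV_coord ord0)//; exact: measurable_rV_coord.
apply: measurable_fun_rVP => i.
rewrite (_ : _ \o _ = rV_coord (lift ord0 i)); first exact: measurable_rV_coord.
by apply/funext => x; rewrite /= /rV_coord mxE.
Qed.

Let rV_consK : cancel (@rV_cons n) rV_uncons.
Proof.
case=> a x; rewrite /rV_uncons /rV_coord /rV_cons mxE unlift_none/=.
by congr pair; apply/rowP => i; rewrite !mxE liftK.
Qed.

Let step_sigma_finite : sigma_finite setT lebesgue_rV_step.
Proof.
have [F TF Foo] := sigma_finite_prod lebesgue_measure mu.
exists (fun k => rV_uncons @^-1` F k).
  by rewrite -preimage_bigcup -TF preimage_setT.
move=> k; have [mF Fk] := Foo k; split.
  by rewrite -[X in measurable X]setTI; exact: measurable_rV_uncons.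
rewrite /lebesgue_rV_step /pushforward -comp_preimage.
by rewrite (_ : _ \o _ = id) ?preimage_id//; apply/funext => x; exact: rV_consK.
Qed.

HB.instance Definition _ := Measure_isSigmaFinite.Build _ _ _ lebesgue_rV_step
  step_sigma_finite.

End step.

(* Lebesgue measure on R^n, as the n-fold product of that of R. *)
Fixpoint lebesgue_rV (n : nat) : {sigma_finite_measure set 'rV[R]_n -> \bar R} :=
  if n is k.+1 then lebesgue_rV_step (lebesgue_rV k) else \d_(0 : 'rV[R]_0).

End lebesgue_rV.

Lemma lebesgue_rV_box (R : realType) (n : nat)
    (A : 'I_n -> set (measurableTypeR R)) :
  (forall i, measurable (A i)) ->
  lebesgue_rV n [set x | forall i, A i (x ord0 i)] =
  (\prod_(i < n) lebesgue_measure (A i))%E.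
Proof.
elim: n A => [|n IHn] A mA.
  have A0 i : A i ((0 : 'rV[R]_0) ord0 i) by case: i.
  by rewrite big_ord0 /= diracE mem_set.
have mbox (m : nat) (B : 'I_m -> set (measurableTypeR R)) : (forall i, measurable (B i)) ->
    measurable [set x : 'rV[R]_m | forall i, B i (x ord0 i)].
  move=> mB; rewrite (_ : [set _ | _] =
      \big[setI/setT]_(i < m) (rV_coord i @^-1` B i)).
    apply: bigsetI_measurable => i _.
    by rewrite -[X in measurable X]setTI; exact: (measurable_rV_coord i measurableT (mB i)).
  apply/seteqP; split => [x Bx|x].
    by rewrite -bigcap_seq => i _; exact: Bx.
  by rewrite -bigcap_seq => Bx i; apply: (Bx i); rewrite /= mem_index_enum.
rewrite big_ord_recl /= /lebesgue_rV_step /pushforward.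
rewrite (_ : _ @^-1` _ = A ord0 `*`
    [set x : 'rV[R]_n | forall i, A (lift ord0 i) (x ord0 i)]); last first.
  apply/seteqP; split => -[a x] /=.
    move=> Aax; split; first by have := Aax ord0; rewrite mxE unlift_none.
    by move=> i; have := Aax (lift ord0 i); rewrite mxE liftK.
  move=> [Aa Ax] i; rewrite mxE.
  by case: (unliftP ord0 i) => [j ->|->].
rewrite (product_measure1E _ _ (mA ord0) (mbox n _ (fun i => mA (lift ord0 i)))).
congr (_ * _)%E; apply: (IHn (fun i => A (lift ord0 i))) => i; exact: mA.
Qed.

Section weak_p_laplace.
Context {R : realType} {n : nat}.
Implicit Types (p c : R) (f psi : 'rV[R]_n -> R) (g : 'rV[R]_n -> 'rV[R]_n).

Local Notation mu := (lebesgue_rV n).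

Definition partial (i : 'I_n) f : 'rV[R]_n -> R := 'D_(delta_mx ord0 i) f.

Definition smooth f : Prop := forall s : seq 'I_n,
  continuous (foldr partial f s) /\
  forall i x, derivable (foldr partial f s) x (delta_mx ord0 i).

Definition test_function psi : Prop :=
  smooth psi /\ compact (closure [set x | psi x != 0]).

Definition loc_integrable f : Prop :=
  measurable_fun setT f /\
  forall K, compact K -> (\int[mu]_(x in K) `|f x|%:E < +oo)%E.

Definition is_weak_gradient f g : Prop :=
  [/\ loc_integrable f,
      forall i, loc_integrable (fun x => g x ord0 i) &
      forall psi i, test_function psi ->
        \int[mu]_x (f x * partial i psi x) =
        - \int[mu]_x (g x ord0 i * psi x)].

Definition weakly_differentiable f : Prop := exists g, is_weak_gradient f g.

(* The weak gradient is unique up to a Lebesgue-null set; grad picks a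
   representative (and is 0 when f has no weak gradient). *)
Definition grad f : 'rV[R]_n -> 'rV[R]_n := xget (cst 0) (is_weak_gradient f).

Definition sobolev1 p f : Prop :=
  [/\ f \in Lfun mu p%:E, weakly_differentiable f &
      forall i, (fun x => grad f x ord0 i) \in Lfun mu p%:E].

Definition dot (v w : 'rV[R]_n) : R := \sum_(i < n) v ord0 i * w ord0 i.

(* Euclidean norm: the norm `|v| of 'rV[R]_n is the sup norm. *)
Definition enorm (v : 'rV[R]_n) : R := Num.sqrt (dot v v).

(* The classical gradient. *)
Definition nabla psi (x : 'rV[R]_n) : 'rV[R]_n := \row_i partial i psi x.

(* When p < 2 and grad f x = 0, powR gives the factor |grad f x|^(p-2) the
   value 0, so that the integrand vanishes there, as it should. *)
Definition p_energy_form p f psi : R :=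
  \int[mu]_x (enorm (grad f x) `^ (p - 2) * dot (grad f x) (nabla psi x)).

Definition p_subsolution p f : Prop :=
  forall psi, test_function psi -> (forall x, 0 <= psi x) ->
    p_energy_form p f psi <= 0.

Definition p_tension p f c : Prop :=
  forall psi, test_function psi ->
    p_energy_form p f psi = - c * \int[mu]_x psi x.

End weak_p_laplace.

(* Main.v *)
From HB Require Import structures.
Require Import Defs.
From mathcomp Require Import all_boot all_order all_algebra.
From mathcomp Require Import all_classical all_reals all_analysis.
From mathcomp Require Import measurable_realfun ring lra.

Import Order.TTheory GRing.Theory Num.Theory.
Import numFieldNormedType.Exports.

Local Open Scope classical_set_scope.
Local Open Scope ring_scope.

(** Let g be the weak gradient of f and F = |g|^(p-2) g its flux. The theorem holds
    because f itself is an admissible test function: this turns the weak equation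
    into the vanishing of the integral of F.g = |g|^p.

    The constant c vanishes: against a bump function of width 1/s with s tending
    to 0, the flux is negligible compared with the integral of the bump function
    (p_tension_constant_eq0). Hence F is orthogonal to the gradient of every test
    function.

    To test with f, take the regularisation u of f by a smooth kernel Phi and cut
    it off. Since f belongs to L^p, the term where the derivative hits the cut-off
    disappears in the limit, and F is orthogonal to the gradient v of u
    (Rintegral_flux_reg_eq0). Regularisation commutes with weak differentiation
    (partial_correlation), so v is the regularisation of g. It remains to let Phi
    concentrate at the origin. The error is an average over small z of the
    integrals of F(x).(g(x) - g(x + z)); by Young's inequality and Tonelli's
    theorem (flux_kernel_le) it is controlled by the continuity of translations in
    L^p (translation_continuity). So the integral of |g|^p is 0 (energy_eq0).

    Continuity of translations is proved for indicator functions of open sets of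
    finite measure, extended to Borel sets by the pi-lambda theorem, and to L^p by
    density of simple functions.

    Finally, with g = 0 almost everywhere, every regularisation of f is a smooth
    function with zero gradient, hence constant, and the continuous function f is
    the pointwise limit of its normalised regularisations
    (constant_of_regularisations). *)

Set Implicit Arguments.
Unset Strict Implicit.
Unset Printing Implicit Defensive.

(** * Borel sets of R^n *)

Lemma normr_rV_lt (R : realType) (n : nat) (x : 'rV[R]_n) (e : R) : 0 < e ->
  `|x| < e <-> forall i, `|x ord0 i| < e.
Proof.
move=> e0; have : ball (0 : 'rV[R]_n) e x <-> `|x| < e.
  by rewrite mx_norm_ball /ball_ /= sub0r normrN.
move=> <-; split=> [[_ h] i|h].
  by have := h ord0 i; rewrite /ball/= mxE sub0r normrN.
split=> // i j; rewrite ord1 /ball/= mxE sub0r normrN; exact: h.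
Qed.

Lemma normr_coord_le (R : realType) (n : nat) (x : 'rV[R]_n) i :
  `|x ord0 i| <= `|x|.
Proof.
apply/ler_addgt0Pl => e e0; rewrite addrC; apply/ltW.
have h : 0 < `|x| + e by rewrite ltr_wpDl.
have /(normr_rV_lt _ h) : `|x| < `|x| + e by rewrite ltrDl.
exact.
Qed.

Lemma measurable_ball_rV (R : realType) (n : nat) (x : 'rV[R]_n) (e : R) :
  0 < e -> measurable [set y : 'rV[R]_n | `|y - x| < e].
Proof.
move=> e0.
rewrite (_ : [set _ | _] = \big[setI/setT]_(i < n)
   (rV_coord i @^-1` `]x ord0 i - e, x ord0 i + e[%classic)).
  apply: bigsetI_measurable => i _; rewrite -[X in measurable X]setTI.
  by apply: measurable_rV_coord => //; exact: measurable_itv.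
rewrite -bigcap_seq; apply/seteqP; split => y /=.
  move=> /(normr_rV_lt _ e0) h i _; have := h i.
  by rewrite /= /rV_coord in_itv/= !mxE -ltr_distlC distrC.
move=> h; apply/(normr_rV_lt _ e0) => i; have := h i.
by rewrite /= mem_index_enum in_itv/= -ltr_distlC distrC !mxE /rV_coord; exact.
Qed.

Lemma measurable_ball0_rV (R : realType) (n : nat) (e : R) :
  0 < e -> measurable [set y : 'rV[R]_n | `|y| < e].
Proof.
move=> /(measurable_ball_rV (0 : 'rV[R]_n)).
by rewrite (_ : [set y | _] = [set y | `|y| < e])//; apply/seteqP; split=> y /=; rewrite subr0.
Qed.

(** R^n is second countable: an open set is the union of the balls with rational
    centre and radius that it contains. *)
Lemma open_measurable_rV (R : realType) (n : nat) (U : set 'rV[R]_n) :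
  open U -> measurable U.
Proof.
move=> oU.
pose rx (q : 'rV[rat]_n) : 'rV[R]_n := \row_i ratr (q ord0 i).
pose B (k : 'rV[rat]_n * nat) : set 'rV[R]_n :=
  [set y | `|y - rx k.1| < k.2.+1%:R^-1].
pose C k := if `[< B k `<=` U >] then B k else set0.
have mC k : measurable (C k).
  rewrite /C; case: ifP => // _; apply: measurable_ball_rV.
  by rewrite invr_gt0 ltr0n.
suff -> : U = \bigcup_(m : nat) (if unpickle m is Some k then C k else set0).
  by apply: bigcupT_measurable => m; case: (unpickle m).
apply/seteqP; split => [x Ux|x [m _]]; last first.
  case: (unpickle m) => // k; rewrite /C; case: ifPn => // /asboolP h.
  exact: h.
have [e /= e0 eU] : exists2 e : R, 0 < e & forall y, `|x - y| < e -> U y.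
  have /nbhs_ballP[e e0 eU] := (open_nbhs_nbhs (conj oU Ux)).
  by exists e => // y xy; apply: eU; rewrite mx_norm_ball.
have [k hk] : exists k : nat, k.+1%:R^-1 < e / 2.
  have e20 : 0 < e / 2 by rewrite divr_gt0.
  exists (Num.truncn (e / 2)^-1).
  by rewrite invf_plt ?posrE ?ltr0n// truncnS_gt// invr_ge0 ltW.
have k0 : 0 < k.+1%:R^-1 :> R by rewrite invr_gt0 ltr0n.
have hq i : exists q : rat, `|x ord0 i - ratr q| < k.+1%:R^-1.
  have [|q hq] := @rat_in_itvoo R (x ord0 i - k.+1%:R^-1) (x ord0 i + k.+1%:R^-1).
    by rewrite ltrD2l gtrN.
  exists q; move: hq; rewrite in_itv/= => /andP[h1 h2].
  by rewrite ltr_distlC h1.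
have [q hq'] := choice hq.
exists (pickle (\row_i q i, k)) => //; rewrite pickleK /C.
have Bx : B (\row_i q i, k) x.
  by rewrite /B/=; apply/(normr_rV_lt _ k0) => i; rewrite !mxE; exact: hq'.
rewrite ifT//; apply/asboolP => y; rewrite /B/= in Bx * => By; apply: eU.
rewrite (_ : x - y = (x - rx (\row_i q i)) - (y - rx (\row_i q i))); last first.
  by rewrite opprB addrA subrK.
rewrite (le_lt_trans (ler_normB _ _))// (splitr e) ltrD//.
  exact: lt_trans Bx hk.
exact: lt_trans By hk.
Qed.

Lemma continuous_measurable_rV (R : realType) (n : nat) (f : 'rV[R]_n -> R) :
  continuous f -> measurable_fun setT f.
Proof.
move=> /continuousP cf; apply: (measurability _ (RGenOpens.measurableE R)).
move=> _ [_ [a [b ->] <-]]; rewrite setTI; apply: open_measurable_rV.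
exact/cf/interval_open.
Qed.

Lemma measurable_addr_rV (R : realType) (n : nat) :
  measurable_fun setT (fun xz : 'rV[R]_n * 'rV[R]_n => xz.1 + xz.2).
Proof.
apply: measurable_fun_rVP => i.
rewrite (_ : _ \o _ = (fun xz => (rV_coord i xz.1 : R) + rV_coord i xz.2)).
  apply: measurable_funD.
    exact: (measurableT_comp (measurable_rV_coord i) measurable_fst).
  exact: (measurableT_comp (measurable_rV_coord i) measurable_snd).
by apply/funext => -[x z]; rewrite /= /rV_coord mxE.
Qed.

Lemma measurable_translate (R : realType) (n : nat) (z : 'rV[R]_n) :
  measurable_fun setT (fun x : 'rV[R]_n => x + z).
Proof.
exact: (measurableT_comp (@measurable_addr_rV R n) (pair2_measurable z)).
Qed.

(** * Translation invariance of Lebesgue measure *)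

Lemma measurable_add_cst (R : realType) (t : R) :
  measurable_fun [set: R] (fun x : R => x + t).
Proof. by apply: measurable_funD. Qed.

Lemma lebesgue_measure_translate (R : realType) (t : R)
    (A : set (measurableTypeR R)) : measurable A ->
  lebesgue_measure [set x : measurableTypeR R | A (x + t)] = lebesgue_measure A.
Proof.
have mt : measurable_fun setT (fun x : measurableTypeR R =>
    x + t : measurableTypeR R).
  exact: measurable_add_cst.
pose T := MeasurableFun.Pack (MeasurableFun.Class
  (isMeasurableFun.Build _ _ _ _ _ mt)).
move=> mA; rewrite [in RHS](@lebesgue_measure_unique _ (pushforward lebesgue_measure T))//.
move=> _ [[a b] _ <-] /=.
rewrite [RHS](_ : _ = lebesgue_measure `]a - t, b - t]%classic).
  by rewrite !lebesgue_measure_itv/= !lte_fin ltrD2r -!EFinB opprB addrA subrK.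
congr lebesgue_measure.
by apply/seteqP; split=> x /=; rewrite !in_itv/= ltrBlDr lerBrDr.
Qed.

Lemma measurable_rV_boxes (R : realType) (n : nat) :
  @measurable _ 'rV[R]_n =
  <<s [set B | exists2 A : 'I_n -> set (measurableTypeR R),
     forall i, measurable (A i) & B = [set x : 'rV[R]_n | forall i, A i (x ord0 i)]] >>.
Proof.
apply/seteqP; split.
  apply: smallest_sub; first exact: smallest_sigma_algebra.
  move=> B; rewrite -bigcup_seq => -[i _ [C mC <-]]; apply: sub_sigma_algebra.
  exists (fun j => if j == i then C else setT).
    by move=> j; case: ifP.
  rewrite setTI; apply/seteqP; split => x /=.
    by move=> Cx j; case: eqP => // ->.
  by move=> /(_ i); rewrite eqxx.
apply: smallest_sub; first exact: sigma_algebra_measurable.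
move=> _ [A mA ->].
rewrite (_ : [set _ | _] = \big[setI/setT]_(i < n) (rV_coord i @^-1` A i)).
  apply: bigsetI_measurable => i _; rewrite -[X in measurable X]setTI.
  exact: measurable_rV_coord.
rewrite -bigcap_seq; apply/seteqP; split => x /= h i; first by move=> _; exact: h.
by apply: h; rewrite /= mem_index_enum.
Qed.

(** The two measures agree on boxes, where the claim is one-dimensional, and boxes
    form a pi-system generating the Borel sets. *)
Lemma lebesgue_rV_translate (R : realType) (n : nat) (z : 'rV[R]_n)
    (A : set 'rV[R]_n) : measurable A ->
  lebesgue_rV n [set x | A (x + z)] = lebesgue_rV n A.
Proof.
pose T := MeasurableFun.Pack (MeasurableFun.Class
  (isMeasurableFun.Build _ _ _ _ _ (measurable_translate z))).
move=> mA; apply/esym.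
pose I k : set (measurableTypeR R) := `]- k%:R, k%:R[%classic.
apply: (@measure_unique _ R 'rV[R]_n _
    (fun k => [set x | forall i, I k (x ord0 i)])
    (measurable_rV_boxes R n) _ _ _ (lebesgue_rV n)
    (pushforward (lebesgue_rV n) T)) => //=.
- move=> _ _ [A1 mA1 ->] [A2 mA2 ->]; exists (fun i => A1 i `&` A2 i).
    by move=> i; exact: measurableI.
  apply/seteqP; split=> [x [h1 h2] i //|x h]; split=> i; by have [] := h i.
- move=> k; exists (fun=> I k) => // i; exact: measurable_itv.
- apply/seteqP; split=> // x _.
  exists (Num.truncn `|x|).+1 => // i; rewrite /I/= in_itv/= -ltr_norml.
  by rewrite (le_lt_trans (normr_coord_le _ _))// truncnS_gt.
- move=> _ [B mB ->].
  rewrite [RHS](_ : _ = lebesgue_rV n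
      [set x | forall i, [set t | B i (t + z ord0 i)] (x ord0 i)]); last first.
    apply: (congr1 (lebesgue_rV n)).
    by apply/seteqP; split=> x /= h i; have := h i; rewrite mxE.
  rewrite (lebesgue_rV_box mB).
  rewrite (@lebesgue_rV_box R n (fun i => [set t | B i (t + z ord0 i)])).
    by apply: eq_bigr => i _; rewrite lebesgue_measure_translate.
  move=> i; rewrite -[X in measurable X]setTI.
  exact: (measurable_add_cst (z ord0 i) measurableT (mB i)).
- move=> k; rewrite (@lebesgue_rV_box R n (fun=> I k)); last first.
    by move=> i; exact: measurable_itv.
  rewrite (eq_bigr (fun=> (k%:R + k%:R)%:E)); last first.
    move=> i _; rewrite lebesgue_measure_itv/= lte_fin -EFinB opprK.
    case: ltP => //; rewrite -subr_le0 opprK => h.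
    by congr EFin; apply/eqP; rewrite eq_le h addr_ge0.
  by rewrite prodEFin ltry.
Qed.

Lemma ge0_integral_translate (R : realType) (n : nat) (z : 'rV[R]_n)
    (h : 'rV[R]_n -> \bar R) : measurable_fun setT h -> (forall x, 0 <= h x)%E ->
  (\int[lebesgue_rV n]_x h (x + z)%R = \int[lebesgue_rV n]_x h x)%E.
Proof.
move=> mh h0.
pose T := MeasurableFun.Pack (MeasurableFun.Class
  (isMeasurableFun.Build _ _ _ _ _ (measurable_translate z))).
have := @ge0_integral_pushforward _ _ _ _ R (fun x : 'rV[R]_n => x + z)
  (measurable_translate z) (lebesgue_rV n) setT h measurableT mh
  (fun x _ => h0 x).
rewrite preimage_setT /comp => <-.
apply: (@eq_measure_integral _ _ R setT (lebesgue_rV n)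
  (pushforward (lebesgue_rV n) T)) => A mA _.
exact: (lebesgue_rV_translate z mA).
Qed.

Lemma Rintegral_translate (R : realType) (n : nat) (z : 'rV[R]_n)
    (h : 'rV[R]_n -> R) : measurable_fun setT h ->
  \int[lebesgue_rV n]_x h (x + z) = \int[lebesgue_rV n]_x h x.
Proof.
move=> mh; rewrite /Rintegral; congr fine.
have mh' : measurable_fun setT (EFin \o h) by exact/measurable_EFinP.
rewrite integralE [RHS]integralE.
rewrite -(@ge0_integral_translate _ _ z ((EFin \o h)^\+)%E)//; last first.
  exact: measurable_funepos.
rewrite -(@ge0_integral_translate _ _ z ((EFin \o h)^\-)%E)//; last first.
  exact: measurable_funeneg.
by congr (_ - _)%E; apply: eq_integral => x _; rewrite ?funeposE ?funenegE.
Qed.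

(** * Continuity of translations in L^p *)

Section powR_extra.
Context {R : realType}.
Implicit Types a b p : R.

Lemma powR_normD_le a b p : 0 <= p ->
  `|a + b| `^ p <= 2 `^ p * (`|a| `^ p + `|b| `^ p).
Proof.
move=> p0; wlog ab : a b / `|a| <= `|b|.
  move=> H; have [|/ltW] := leP `|a| `|b|; first exact: H.
  by rewrite addrC [X in _ * X]addrC; exact: H.
apply: (@le_trans _ _ ((2 * `|b|) `^ p)).
  apply: ge0_ler_powR; rewrite ?nnegrE// ?mulr_ge0//.
  by rewrite (le_trans (ler_normD _ _))// mulr_natl mulr2n lerD2r.
rewrite powRM// ler_wpM2l ?powR_ge0// lerDr powR_ge0//.
Qed.

Lemma powR_norm_small p e : 0 < p -> 0 < e ->
  exists2 d, 0 < d & forall a, `|a| < d -> `|a| `^ p < e.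
Proof.
move=> p0 e0; exists (e `^ p^-1); first by rewrite powR_gt0.
move=> a ad; rewrite -[ltRHS]powRr1 ?(ltW e0)// -(mulVf (lt0r_neq0 p0)) powRrM.
by apply: gt0_ltr_powR; rewrite ?nnegrE ?powR_ge0.
Qed.

End powR_extra.

Section Lp_translation.
Context {R : realType} {n : nat}.
Local Notation mu := (lebesgue_rV n).
Local Notation T := 'rV[R]_n.
Variable p : R.
Hypothesis p0 : 0 < p.
Implicit Types (h g : T -> R) (A B U : set T).

(** The p-th power of the L^p norm, in the extended reals so that estimates need
    no integrability assumption. *)
Definition pmass h : \bar R := (\int[mu]_x (`|h x| `^ p)%:E)%E.

Lemma measurable_pmass h : measurable_fun setT h ->
  measurable_fun setT (fun x => (`|h x| `^ p)%:E).
Proof.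
move=> mh; apply/measurable_EFinP.
apply: (measurableT_comp (measurable_powR p)).
exact: (measurableT_comp (@normr_measurable R setT)).
Qed.

Lemma pmassD_le h g : measurable_fun setT h -> measurable_fun setT g ->
  (pmass (fun x => h x + g x)%R <= (2 `^ p)%:E * (pmass h + pmass g))%E.
Proof.
move=> mh mg; rewrite /pmass -ge0_integralD//; last 2 first.
- exact: measurable_pmass.
- exact: measurable_pmass.
rewrite -ge0_integralZl_EFin ?powR_ge0//; last 2 first.
- by move=> x _; rewrite -EFinD lee_fin addr_ge0// powR_ge0.
- by apply: emeasurable_funD; exact: measurable_pmass.
apply: ge0_le_integral => //.
- by apply: measurable_pmass; exact: measurable_funD.
- by apply: measurable_funeM; apply: emeasurable_funD; exact: measurable_pmass.
- by move=> x _; rewrite -EFinD -EFinM lee_fin powR_normD_le// ltW.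
Qed.

Lemma pmass_translate h z : measurable_fun setT h ->
  pmass (fun x : T => h (x + z)) = pmass h.
Proof.
move=> mh; apply: (@ge0_integral_translate _ _ z (fun x => (`|h x| `^ p)%:E)).
  exact: measurable_pmass.
by move=> x; rewrite lee_fin powR_ge0.
Qed.

Lemma pmassN h : pmass (fun x => - h x) = pmass h.
Proof. by apply: eq_integral => x _; rewrite normrN. Qed.

Lemma pmassZ c h : measurable_fun setT h ->
  pmass (fun x => c * h x) = ((`|c| `^ p)%:E * pmass h)%E.
Proof.
move=> mh; rewrite /pmass -ge0_integralZl_EFin ?powR_ge0//; last first.
  exact: measurable_pmass.
by apply: eq_integral => x _; rewrite normrM powRM.
Qed.

Lemma pmass_indic A : measurable A -> pmass \1_A = mu A.
Proof.
move=> mA; rewrite -[in RHS](setIT A) -integral_indic//.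
apply: eq_integral => x _; rewrite indicE; case: (x \in A) => /=.
  by rewrite normr1 powR1.
by rewrite normr0 powR0// lt0r_neq0.
Qed.

(** Continuity at 0 of the L^p-valued map sending z to the translate of h by z;
    L^p convergence of regularisations will be deduced from it. *)
Definition translation_continuous h := measurable_fun setT h /\
  forall d : R, 0 < d -> exists2 r : R, 0 < r &
    forall z : T, `|z| < r -> (pmass (fun x : T => h (x + z) - h x)%R <= d%:E)%E.

Local Notation tc := translation_continuous.

Lemma measurable_fun_translate h (z : T) : measurable_fun setT h ->
  measurable_fun setT (fun x : T => h (x + z)).
Proof. by move=> mh; exact: (measurableT_comp mh (measurable_translate z)). Qed.

Lemma translation_continuousD h g : tc h -> tc g -> tc (fun x => h x + g x).
Proof.
move=> [mh th] [mg tg]; split; first exact: measurable_funD.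
move=> d d0.
have d'0 : 0 < (2 `^ p)^-1 * (d / 2).
  by rewrite mulr_gt0 ?invr_gt0 ?powR_gt0// divr_gt0.
have [r r0 hr] := th _ d'0; have [s s0 hs] := tg _ d'0.
exists (Num.min r s); first by rewrite lt_min r0.
move=> z; rewrite lt_min => /andP[zr zs].
rewrite (_ : (fun x => _) =
    (fun x => (h (x + z) - h x) + (g (x + z) - g x))); last first.
  by apply/funext => x; rewrite opprD addrACA.
apply: (le_trans (pmassD_le _ _)).
- by apply: measurable_funB => //; exact: measurable_fun_translate.
- by apply: measurable_funB => //; exact: measurable_fun_translate.
apply: (@le_trans _ _ ((2 `^ p)%:E * (((2 `^ p)^-1 * (d / 2))%:E +
    ((2 `^ p)^-1 * (d / 2))%:E))%E).
  by apply: lee_wpmul2l; rewrite ?lee_fin ?powR_ge0//; apply: leeD; auto.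
by rewrite -EFinD -EFinM lee_fin -mulrDr mulrA divff ?mul1r -?splitr.
Qed.

Lemma translation_continuousZ c h : tc h -> tc (fun x => c * h x).
Proof.
move=> [mh th]; split; first exact: measurable_funM.
move=> d d0; have C0 : 0 < `|c| `^ p + 1 by rewrite ltr_wpDl ?powR_ge0.
have [r r0 hr] := th _ (divr_gt0 d0 C0).
exists r => // z zr.
rewrite (_ : (fun x => _) = (fun x => c * (h (x + z) - h x))); last first.
  by apply/funext => x; rewrite mulrBr.
rewrite pmassZ; last by apply: measurable_funB => //; exact: measurable_fun_translate.
apply: (@le_trans _ _ ((`|c| `^ p)%:E * (d / (`|c| `^ p + 1))%:E)%E).
  by apply: lee_wpmul2l; [rewrite lee_fin powR_ge0|exact: hr].
rewrite -EFinM lee_fin mulrCA ger_pMr// ler_pdivrMr// mul1r lerDl//.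
Qed.

Lemma translation_continuousB h g : tc h -> tc g -> tc (fun x => h x - g x).
Proof.
move=> th tg; rewrite (_ : (fun x => _) = (fun x => h x + (-1) * g x)).
  exact: (translation_continuousD th (translation_continuousZ (-1) tg)).
by apply/funext => x; rewrite mulN1r.
Qed.

Lemma translation_continuous0 : tc (cst 0).
Proof.
split=> // d d0; exists 1 => // z _.
rewrite /pmass (eq_integral (cst 0%E)) ?integral0 ?lee_fin ?(ltW d0)//.
by move=> x _; rewrite subrr normr0 powR0// lt0r_neq0.
Qed.

Lemma translation_continuous_sum (I : Type) (s : seq I) (F : I -> T -> R) :
  (forall i, tc (F i)) -> tc (fun x => \sum_(i <- s) F i x).
Proof.
move=> tF; elim: s => [|i s ih].
  have -> : (fun x => \sum_(i <- [::]) F i x) = cst 0.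
    by apply/funext => x; rewrite big_nil.
  exact: translation_continuous0.
have -> : (fun x => \sum_(j <- i :: s) F j x) =
    (fun x => F i x + \sum_(j <- s) F j x).
  by apply/funext => x; rewrite big_cons.
exact: (translation_continuousD (tF i) ih).
Qed.

(** Translations are isometries of L^p, so the class is closed in L^p. *)
Lemma translation_continuous_approx g : measurable_fun setT g ->
  (forall d : R, 0 < d -> exists2 h, tc h & (pmass (fun x => g x - h x)%R <= d%:E)%E) ->
  tc g.
Proof.
move=> mg H; split=> // d d0.
have c0 : 0 < 2 `^ p :> R by rewrite powR_gt0.
have d'0 : 0 < (2 `^ p)^-1 * ((2 `^ p)^-1 * (d / 4)).
  by rewrite mulr_gt0 ?mulr_gt0 ?invr_gt0// ?divr_gt0.
have [h [mh th] gh] := H _ d'0.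
have d''0 : 0 < (2 `^ p)^-1 * (d / 2) by rewrite mulr_gt0 ?invr_gt0 ?divr_gt0.
have [r r0 hr] := th _ d''0.
have mgh : measurable_fun setT (fun x => g x - h x)%R by exact: measurable_funB.
exists r => // z zr.
rewrite (_ : (fun x => _) = (fun x => (h (x + z) - h x) +
    ((g (x + z) - h (x + z)) + - (g x - h x)))); last first.
  by apply/funext => x; ring.
apply: (le_trans (pmassD_le _ _)).
- by apply: measurable_funB => //; exact: measurable_fun_translate.
- apply: measurable_funD; first exact: (measurable_fun_translate z mgh).
  exact: measurable_funN.
have h2 : (pmass (fun x => (g (x + z) - h (x + z)) + - (g x - h x))%R <=
    ((2 `^ p)^-1 * (d / 2))%:E)%E.
  apply: (le_trans (pmassD_le _ _)).
  - exact: (measurable_fun_translate z mgh).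
  - exact: measurable_funN.
  rewrite (pmass_translate z mgh) pmassN.
  apply: (@le_trans _ _ ((2 `^ p)%:E * (((2 `^ p)^-1 * ((2 `^ p)^-1 * (d / 4)))%:E +
      ((2 `^ p)^-1 * ((2 `^ p)^-1 * (d / 4)))%:E))%E).
    by apply: lee_wpmul2l; rewrite ?lee_fin ?(ltW c0)//; apply: leeD.
  rewrite -EFinD -EFinM lee_fin -mulrDr mulrA divff ?mul1r ?lt0r_neq0//.
  by rewrite -mulrDr ler_wpM2l// ?invr_ge0 ?(ltW c0)//; lra.
apply: (@le_trans _ _ ((2 `^ p)%:E * (((2 `^ p)^-1 * (d / 2))%:E +
    ((2 `^ p)^-1 * (d / 2))%:E))%E).
  by apply: lee_wpmul2l; rewrite ?lee_fin ?(ltW c0)//; apply: leeD; auto.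
by rewrite -EFinD -EFinM lee_fin -mulrDr mulrA divff ?mul1r -?splitr.
Qed.

End Lp_translation.

Lemma lebesgue_rV_ball (R : realType) (n : nat) (r : R) : 0 < r ->
  lebesgue_rV n [set x | `|x| < r] = ((2 * r) ^+ n)%:E.
Proof.
move=> r0; rewrite (_ : [set x | _] =
    [set x : 'rV[R]_n | forall i, `]- r, r[%classic (x ord0 i)]); last first.
  apply/seteqP; split=> x /=.
    by move=> /(normr_rV_lt _ r0) h i; rewrite in_itv/= -ltr_norml.
  move=> h; apply/(normr_rV_lt _ r0) => i.
  by have := h i; rewrite in_itv/= -ltr_norml.
rewrite (@lebesgue_rV_box R n (fun=> `]- r, r[%classic)); last first.
  by move=> i; exact: measurable_itv.
rewrite (eq_bigr (fun=> (2 * r)%:E)); last first.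
  move=> i _; rewrite lebesgue_measure_itv/= lte_fin gtrN// -EFinB opprK.
  by rewrite mulr_natl.
by rewrite prodEFin prodr_const card_ord.
Qed.

Lemma cvge0_exists_le (R : realType) (u : (\bar R)^nat) (d : R) : 0 < d ->
  u @ \oo --> 0%E -> exists k, (u k <= d%:E)%E.
Proof.
move=> d0 u0; have : \forall k \near \oo, (u k < d%:E)%E.
  by apply: (u0 [set y | (y < d%:E)%E]); apply: open_ereal_lt'; rewrite lte_fin.
by case=> N _ h; exists N; apply/ltW/h => /=.
Qed.

Lemma measurable_rV_open (R : realType) (n : nat) (A : set 'rV[R]_n) :
  measurable A -> <<s [set U : set 'rV[R]_n | open U] >> A.
Proof.
apply: smallest_sub; first exact: smallest_sigma_algebra.
move=> B; rewrite -bigcup_seq => -[i _ [C mC <-]]; rewrite setTI.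
pose S := [set C : set R | <<s [set U : set 'rV[R]_n | open U] >>
  (rV_coord i @^-1` C)].
have : <<s [set A : set R | exists x y, A = `]x, y[%classic] >> `<=` S.
  have [S0 SC SU] := smallest_sigma_algebra setT [set U : set 'rV[R]_n | open U].
  apply: smallest_sub.
    split.
    - by rewrite /S/= preimage_set0.
    - by move=> D /= SD; rewrite /S/= setTD preimage_setC -setTD; exact: SC.
    - by move=> F SF; rewrite /S/= preimage_bigcup; exact: SU.
  move=> _ [x [y ->]]; apply: sub_sigma_algebra => /=.
  apply: open_comp; last exact: interval_open.
  by move=> z _; exact: coord_continuous.
apply.
have : (@RGenOpens.G R).-sigma.-measurable C by rewrite -RGenOpens.measurableE.
exact.
Qed.

Section Lp_translation.
Context {R : realType} {n : nat}.
Local Notation mu := (lebesgue_rV n).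
Local Notation T := 'rV[R]_n.
Variable p : R.
Hypothesis p0 : 0 < p.
Implicit Types (h g : T -> R) (A B U : set T).
Local Notation tc := (translation_continuous p).

(** A point of an open set U that leaves U under a small translation is close to
    the complement of U, and the set of such points shrinks to the empty set.
    Points entering U are handled by the opposite translation. *)
Lemma translation_continuous_indic_open U : open U -> (mu U < +oo)%E -> tc \1_U.
Proof.
move=> oU Uoo; have mU := open_measurable_rV oU.
split=> // d d0.
pose W (k : nat) := [set x : T | forall z : T, `|z| < k.+1%:R^-1 -> U (x + z)].
have mW k : measurable (W k).
  rewrite -[W k]setCK; apply: measurableC; apply: open_measurable_rV.
  rewrite openE => x /= /existsNP[z /not_implyP[zk Uxz]].
  apply/nbhs_ballP; exists (k.+1%:R^-1 - `|z|); first by rewrite /= subr_gt0.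
  move=> y; rewrite mx_norm_ball /ball_ /= => xy; apply/existsNP.
  exists (z + (x - y)); apply/not_implyP; split.
    by rewrite (le_lt_trans (ler_normD _ _))// -ltrBrDl.
  by rewrite addrCA [y + _]addrC subrK addrC.
have [k hk] : exists k, (mu (U `\` W k) <= (d / 2)%:E)%E.
  apply: (cvge0_exists_le (divr_gt0 d0 _)) => //.
  rewrite -(measure0 mu).
  have <- : \bigcap_k (U `\` W k) = set0.
    apply/seteqP; split=> // x h.
    have [Ux _] := h 0%N I.
    have /nbhs_ballP[e /= e0 eU] := open_nbhs_nbhs (conj oU Ux).
    have [_] := h (Num.truncn e^-1) I; apply => z ze; apply: eU.
    rewrite mx_norm_ball /ball_ /= opprD addNKr normrN (lt_trans ze)//.
    by rewrite invf_plt ?posrE ?ltr0n// truncnS_gt// invr_ge0 ltW.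
  apply: nonincreasing_cvg_mu.
  - rewrite (le_lt_trans _ Uoo)//; apply: le_measure; rewrite ?inE//.
    exact: measurableD.
  - by move=> i; exact: measurableD.
  - by apply: bigcapT_measurable => i; exact: measurableD.
  - move=> i j ij; apply/subsetPset => x [Ux nW]; split => // Wx; apply: nW.
    move=> z zj; apply: Wx; rewrite (lt_le_trans zj)//.
    by rewrite lef_pV2 ?posrE ?ltr0n// ler_nat.
exists k.+1%:R^-1; first by rewrite invr_gt0 ltr0n.
pose V (w : T) := U `\` [set x : T | U (x + w)].
have mV w : measurable (V w).
  apply: measurableD => //; rewrite -[X in measurable X]setTI.
  exact: (measurable_translate w).
have V_le w : `|w| < k.+1%:R^-1 -> (mu (V w) <= (d / 2)%:E)%E.
  move=> wk; apply: (le_trans _ hk); apply: le_measure; rewrite ?inE//.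
    exact: measurableD.
  by move=> x [Ux nU]; split=> // Wx; exact: nU (Wx _ wk).
move=> z zk.
apply: (@le_trans _ _ (\int[mu]_x ((\1_(V z) x)%:E +
    (\1_(V (- z)) (x + z)%R)%:E))%E).
  apply: ge0_le_integral => //.
  - apply: (measurable_pmass p); apply: measurable_funB => //.
    exact: (@measurable_fun_translate _ _ (\1_U : T -> R)).
  - apply: emeasurable_funD; apply/measurable_EFinP => //.
    exact: (@measurable_fun_translate _ _ (\1_(V (- z)) : T -> R)).
  - move=> x _; rewrite -EFinD lee_fin.
    have [Ux|nUx] := pselect (U x); have [Uxz|nUxz] := pselect (U (x + z)).
    + rewrite !indicE (mem_set Ux) (mem_set Uxz)/= subrr normr0 powR0 ?lt0r_neq0//.
    + rewrite !indicE (mem_set Ux) (memNset nUxz)/= sub0r normrN normr1 powR1.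
      by rewrite (@mem_set _ (V z) x)//= lerDl.
    + rewrite !indicE (memNset nUx) (mem_set Uxz)/= subr0 normr1 powR1.
      by rewrite (@mem_set _ (V (- z)) (x + z)) ?lerDr//; split; rewrite //= addrK.
    + rewrite !indicE (memNset nUx) (memNset nUxz)/= subrr normr0 powR0 ?lt0r_neq0//.
rewrite ge0_integralD//; last 2 first.
- by apply/measurable_EFinP.
- apply/measurable_EFinP.
  exact: (@measurable_fun_translate _ _ (\1_(V (- z)) : T -> R)).
rewrite (@ge0_integral_translate _ _ z (fun x => (\1_(V (- z)) x)%:E)); last 2 first.
- by apply/measurable_EFinP.
- by move=> x; rewrite lee_fin.
rewrite !integral_indic// !setIT.
by rewrite [d]splitr EFinD; apply: leeD; apply: V_le; rewrite ?normrN.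
Qed.

(** Inside a fixed ball all measures are finite, and the sets A for which the
    conclusion holds form a lambda-system containing the pi-system of open sets. *)
Lemma translation_continuous_indic A (r : R) : 0 < r -> measurable A ->
  tc \1_(A `&` [set x | `|x| < r]).
Proof.
move=> r0; set Q : set T := [set x | _].
have oQ : open Q.
  rewrite /Q (_ : [set x | _] = ball (0 : T) r); first exact: ball_open.
  by rewrite mx_norm_ball /ball_; apply/seteqP; split=> x /=; rewrite sub0r normrN.
have Qoo : (mu Q < +oo)%E by rewrite lebesgue_rV_ball// ltry.
have mQ := open_measurable_rV oQ.
move=> mA; pose D := [set A | measurable A /\ tc \1_(A `&` Q)].
suff : D A by case.
apply: (@lambda_system_subset _ [set U : set T | open U] _ setT D); last 2 first.
- by [].
- exact: measurable_rV_open.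
- by move=> U V oU oV; exact: openI.
- split.
  + by move=> B _ x _.
  + by split; [exact: measurableT|rewrite setTI; exact: translation_continuous_indic_open].
  + move=> B C CB [mB tB] [mC tC]; split; first exact: measurableD.
    rewrite (_ : \1_ _ = (fun x => \1_(B `&` Q) x - \1_(C `&` Q) x)).
      exact: (translation_continuousB p0 tB tC).
    apply/funext => x; rewrite !indicE !classical_sets.in_setI.
    rewrite (classical_sets.in_setC x C).
    have [xQ|] := boolP (x \in Q); last by rewrite !andbF subrr.
    rewrite !andbT; have [xC|xC] := boolP (x \in C); rewrite ?subr0 ?andbT//.
    by rewrite (mem_set (CB _ (set_mem xC))) subrr.
  + move=> F ndF DF; have mF k : measurable (F k) by case: (DF k).
    have mUF : measurable (\bigcup_k F k) by exact: bigcupT_measurable.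
    split => //; apply: translation_continuous_approx => //.
      by apply: measurable_indic; exact: measurableI.
    move=> d d0.
    have [k hk] : exists k, (mu (((\bigcup_k F k) `\` F k) `&` Q) <= d%:E)%E.
      apply: (cvge0_exists_le d0); rewrite -(measure0 mu).
      have <- : \bigcap_k (((\bigcup_k F k) `\` F k) `&` Q) = set0.
        apply/seteqP; split=> // x h.
        by have [[[k _ Fx] _] _] := h 0%N I; have [[_ /(_ Fx)]] := h k I.
      have mG i : measurable (((\bigcup_k F k) `\` F i) `&` Q).
        by apply: measurableI => //; exact: measurableD.
      apply: nonincreasing_cvg_mu => //.
      * rewrite (le_lt_trans _ Qoo)//; apply: le_measure; rewrite ?inE//.
      * exact: bigcapT_measurable.
      * move=> i j ij; apply/subsetPset; apply: setSI; apply: setDS.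
        exact/subsetPset/ndF.
    exists \1_(F k `&` Q); first by case: (DF k).
    rewrite (_ : (fun x => _) = \1_(((\bigcup_k F k) `\` F k) `&` Q)).
      by rewrite pmass_indic//; apply: measurableI => //; exact: measurableD.
    apply/funext => x; rewrite !indicE !classical_sets.in_setI.
    rewrite (classical_sets.in_setC x (F k)).
    have [xQ|] := boolP (x \in Q); last by rewrite !andbF subrr.
    rewrite !andbT; have [xC|xC] := boolP (x \in F k); rewrite ?subr0 ?andbT//.
    rewrite mem_set ?subrr//; exists k => //; exact: set_mem.
- move=> U oU; have mU := open_measurable_rV oU; split => //.
  apply: translation_continuous_indic_open; first exact: openI.
  by rewrite (le_lt_trans _ Qoo)//; apply: le_measure; rewrite ?inE//; exact: measurableI.
Qed.

End Lp_translation.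

Section Lp_translation.
Context {R : realType} {n : nat}.
Local Notation mu := (lebesgue_rV n).
Local Notation T := 'rV[R]_n.
Variable p : R.
Hypothesis p0 : 0 < p.
Local Notation tc := (translation_continuous p).

Import HBNNSimple.

Lemma translation_continuous_simple (h : {nnsfun T >-> R}) (r : R) : 0 < r ->
  tc (fun x => h x * \1_[set x | `|x| < r] x).
Proof.
move=> r0; set Q : set T := [set x | _].
have -> : (fun x => h x * \1_Q x) = (fun x => \sum_(y <- finmap.enum_fset (fset_set (range h)))
    (y * \1_((h @^-1` [set y]) `&` Q) x)).
  apply/funext => x; rewrite fimfunE fsbig_finite//= mulr_suml.
  by apply: eq_bigr => y _; rewrite !indicE classical_sets.in_setI -mulrA -natrM mulnb.
apply: (translation_continuous_sum p0) => y.
have tA : tc \1_((h @^-1` [set y]) `&` Q).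
  by apply: (translation_continuous_indic p0 r0); exact: measurable_sfunP.
exact: (translation_continuousZ y tA).
Qed.

Lemma translation_continuous_ge0 (g : T -> R) : measurable_fun setT g -> (forall x, 0 <= g x) ->
  (pmass p g < +oo)%E -> tc g.
Proof.
move=> mg g0 goo.
have mEg : measurable_fun setT (EFin \o g) by exact/measurable_EFinP.
have Eg0 x : [set: T] x -> (0 <= (EFin \o g) x)%E by rewrite lee_fin.
pose s k := nnsfun_approx measurableT mEg k.
pose Q (k : nat) : set T := [set x | `|x| < k.+1%:R].
have sg k x : s k x <= g x.
  by rewrite -lee_fin /s nnsfun_approxE; exact: le_approx.
have s_cvg x : s k x @[k --> \oo] --> g x.
  have /fine_cvgP[_] := @cvg_nnsfun_approx _ T R _ measurableT _ mEg Eg0 x I.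
  exact.
pose h k x : R := s k x * \1_(Q k) x.
have mh k : measurable_fun setT (h k) by have [] := translation_continuous_simple (s k) (ltr0Sn R k).
have h0 k x : 0 <= h k x by rewrite mulr_ge0.
have hg k x : h k x <= g x.
  rewrite /h indicE; case: (x \in _) => /=; rewrite ?mulr1 ?mulr0//.
apply: (translation_continuous_approx p0 mg) => d d0.
have [k hk] : exists k, (pmass p (fun x => g x - h k x)%R <= d%:E)%E; last first.
  by exists (h k) => //; exact: translation_continuous_simple.
apply: (cvge0_exists_le d0).
rewrite -(@integral0 _ T R mu setT).
apply: (@dominated_cvg _ T R mu setT measurableT
  (fun k x => (`|g x - h k x| `^ p)%:E) _ (fun x => (`|g x| `^ p)%:E)).
- by move=> k; apply: (measurable_pmass p); exact: measurable_funB.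
- move=> x _; apply/fine_cvgP; split; first exact: nearW.
  apply/cvgrPdist_lt => e e0 /=.
  have [b b0 hb] := powR_norm_small p0 e0.
  have /cvgrPdist_lt/(_ b b0) := s_cvg x.
  move=> [N _ hN]; exists (maxn N (Num.truncn `|x|)) => // k /=.
  rewrite geq_max => /andP[Nk xk].
  rewrite sub0r normrN ger0_norm ?powR_ge0//; apply: hb.
  have := hN k Nk; rewrite /h indicE mem_set ?mulr1//.
  by rewrite /Q/= -truncn_le_nat ?ltnS// (leq_ltn_trans xk).
- by [].
- apply/integrableP; split; first exact: measurable_pmass.
  apply: le_lt_trans goo; rewrite le_eqVlt; apply/orP; left; apply/eqP.
  by apply: eq_integral => x _; rewrite gee0_abs// lee_fin powR_ge0.
- move=> k x _; rewrite gee0_abs ?lee_fin ?powR_ge0//.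
  apply: ge0_ler_powR; rewrite ?nnegrE ?(ltW p0)//.
  by rewrite !ger0_norm ?subr_ge0// gerBl.
Qed.

(** Simple functions of bounded support are dense in L^p, so the translation
    continuity of indicator functions passes to the whole space. *)
Lemma translation_continuity (g : T -> R) : measurable_fun setT g ->
  (pmass p g < +oo)%E -> tc g.
Proof.
move=> mg goo; rewrite -[g]funrposBneg.
apply: (translation_continuousB p0); apply: translation_continuous_ge0.
- exact: measurable_funrpos.
- exact: funrpos_ge0.
- apply: le_lt_trans goo; apply: ge0_le_integral => //.
  + by apply: (measurable_pmass p); exact: measurable_funrpos.
  + exact: (measurable_pmass p).
  + move=> x _; rewrite lee_fin; apply: ge0_ler_powR; rewrite ?nnegrE ?(ltW p0)//.
    rewrite ger0_norm ?funrpos_ge0// /funrpos.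
    by rewrite ge_max ler_norm normr_ge0.
- exact: measurable_funrneg.
- exact: funrneg_ge0.
- apply: le_lt_trans goo; apply: ge0_le_integral => //.
  + by apply: (measurable_pmass p); exact: measurable_funrneg.
  + exact: (measurable_pmass p).
  + move=> x _; rewrite lee_fin; apply: ge0_ler_powR; rewrite ?nnegrE ?(ltW p0)//.
    rewrite ger0_norm ?funrneg_ge0// /funrneg.
    by rewrite ge_max -normrN ler_norm normr_ge0.
Qed.

End Lp_translation.

(** * A smooth bump function *)

Section exp_inv.
Context {R : realType}.
Implicit Types (P : {poly R}) (t : R).

(** The functions P(1/t) exp(-1/t), extended by 0 to the left of the origin,
    form a class closed under differentiation: this is why they are smooth. *)
Definition exp_inv P t : R := if 0 < t then P.[t^-1] * expR (- t^-1) else 0.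

(** Bound each monomial by y^k exp(-y) <= k!, a term of the exponential series. *)
Lemma exp_decay_bound P : exists2 M : R, 0 <= M &
  forall y, 0 < y -> `|P.[y]| * expR (- y) <= M.
Proof.
have mono k (y : R) : 0 < y -> y ^+ k * expR (- y) <= k`!%:R.
  move=> y0; rewrite expRN ler_pdivrMr ?expR_gt0//.
  case: k => [|k].
    by rewrite fact0 mul1r expr0 (le_trans _ (expR_ge1Dx _))// lerDl ltW.
  have k0 : (0 : R) < (k.+1)`!%:R by rewrite ltr0n fact_gt0.
  rewrite mulrC -ler_pdivrMr// (le_trans _ (expR_ge1Dxn k (ltW y0)))//.
  by rewrite lerDr.
exists (\sum_(i < size P) `|P`_i| * i`!%:R).
  by apply: sumr_ge0 => i _; rewrite mulr_ge0.
move=> y y0; rewrite horner_coef.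
apply: (@le_trans _ _ ((\sum_(i < size P) `|P`_i| * y ^+ i) * expR (- y))).
  rewrite ler_wpM2r ?expR_ge0// (le_trans (ler_norm_sum _ _ _))//.
  by apply: ler_sum => i _; rewrite normrM normrX (gtr0_norm y0).
rewrite mulr_suml; apply: ler_sum => i _; rewrite -mulrA ler_wpM2l//; exact: mono.
Qed.

(** Only the origin needs an argument: with y = 1/h, boundedness of
    y^2 P(y) exp(-y) makes the difference quotient of order h. *)
Lemma is_derive_exp_inv P t :
  is_derive t 1 (exp_inv P) (exp_inv ('X^2 * (P - P^`())) t).
Proof.
have [t0|t0|<-] := ltgtP 0 t.
- have h : is_derive t 1 (fun u : R => u^-1) (- t ^- 2).
    apply: is_derive_eq; first exact: (@is_deriveV _ (fun u => u) _ _ _ (lt0r_neq0 t0)).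
    by rewrite /GRing.scale/= mulr1.
  have h1 : is_derive t 1 (fun u : R => P.[u^-1]) (P^`().[t^-1] * (- t ^- 2)).
    exact: (@is_derive1_comp _ (horner P) (fun u => u^-1)).
  have h2 : is_derive t 1 (fun u : R => expR (- u^-1)) (expR (- t^-1) * (t ^- 2)).
    apply: (@is_derive1_comp _ expR (fun u => - u^-1)).
    by rewrite -[X in is_derive _ _ _ X]opprK; exact: is_deriveN.
  apply: (@near_eq_is_derive _ _ _ (fun u : R => P.[u^-1] * expR (- u^-1))).
    near=> u; rewrite /exp_inv ifT//; near: u; exact: lt_nbhsr.
  have h3 := is_deriveM h1 h2.
  refine (@is_derive_eq _ _ _ _ _ _ _ _ h3 _).
  rewrite /exp_inv t0 /GRing.scale/= !hornerE/=.
  by rewrite exprVn; ring.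
- apply: (@near_eq_is_derive _ _ _ (cst 0)).
    near=> u; rewrite /exp_inv ifF//; apply/negbTE; rewrite -leNgt ltW//.
    near: u; exact: lt_nbhsl.
  by apply: is_derive_eq; rewrite /exp_inv ltNge (ltW t0).
- have [M M0 hM] := exp_decay_bound ('X^2 * P).
  have lim0 : h^-1 *: (exp_inv P (h *: 1 + 0) - exp_inv P 0) @[h --> 0^'] --> (0 : R).
    apply/cvgrPdist_lt => e e0.
    exists (e / (M + 1)); first by rewrite /= divr_gt0// ltr_wpDl.
    move=> h /=; rewrite sub0r normrN => he h0.
    rewrite sub0r normrN addr0 [h *: 1]mulr1 /exp_inv ltxx subr0.
    case: ifPn => [hp|_]; last by rewrite scaler0 normr0.
    have hip : 0 < h^-1 by rewrite invr_gt0.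
    have := hM _ hip; rewrite !hornerE normrM (ger0_norm (exprn_ge0 _ (ltW hip))).
    rewrite expr2 -!mulrA ler_pdivrMl// => hle.
    rewrite /GRing.scale/= !normrM (gtr0_norm hip) (ger0_norm (expR_ge0 _)).
    rewrite (le_lt_trans hle)//.
    have M1 : 0 < M + 1 by rewrite ltr_wpDl.
    move: he; rewrite gtr0_norm// ltr_pdivlMr// => he.
    by rewrite (le_lt_trans _ he)// ler_wpM2l ?(ltW hp)// lerDl.
  have -> : exp_inv ('X^2 * (P - P^`())) 0 = 0 by rewrite /exp_inv ltxx.
  split; first by apply/cvg_ex; exists 0.
  by rewrite /derive; apply: cvg_lim.
Unshelve. all: by end_near. Qed.


Lemma exp_inv_ge0 t : 0 <= exp_inv 1 t.
Proof. by rewrite /exp_inv; case: ifP => // _; rewrite hornerC mul1r expR_ge0. Qed.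

Lemma exp_inv_le1 t : exp_inv 1 t <= 1.
Proof.
rewrite /exp_inv; case: ifPn => // t0; rewrite hornerC mul1r expR_le1.
by rewrite oppr_le0 invr_ge0 ltW.
Qed.

Lemma exp_inv_half t : 2^-1 < t -> expR (- 2) <= exp_inv 1 t.
Proof.
move=> t2; have t0 : 0 < t by rewrite (lt_trans _ t2)// invr_gt0.
rewrite /exp_inv t0 hornerC mul1r ler_expR lerN2 -[leRHS]invrK lef_pV2 ?posrE ?invr_gt0//.
exact: ltW.
Qed.

Lemma continuous_exp_inv P : continuous (exp_inv P).
Proof.
move=> t; apply/differentiable_continuous/derivable1_diffP.
by have [] := is_derive_exp_inv P t.
Qed.

End exp_inv.
Arguments continuous_exp_inv {R} P.

(** * Smooth functions on R^n *)

Section smooth.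
Context {R : realType} {n : nat}.
Local Notation T := 'rV[R]_n.
Local Notation e_ i := (delta_mx ord0 i : T).
Implicit Types (f g : T -> R).

Lemma is_derive_line f x v d :
  is_derive x v f d <-> is_derive (0 : R) 1 (fun h : R => f (h *: v + x)) d.
Proof.
pose l (h : R) := f (h *: v + x).
have E : (fun h : R => h^-1 *: ((f \o shift x) (h *: v) - f x)) =
    (fun h : R => h^-1 *: ((l \o shift 0) (h *: 1) - l 0)).
  apply/funext => h; rewrite /l /=.
  by rewrite addr0 scale0r add0r [_%:A]mulr1.
have Ed : derivable f x v = derivable l 0 1 by rewrite /derivable E.
have ED : 'D_v f x = 'D_1 l 0 by rewrite /derive E.
by split=> -[fx <-]; split; rewrite -/l ?Ed ?ED// -?Ed -?ED.
Qed.

(** Any class closed under partial derivatives whose members are continuous and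
    have partial derivatives consists of smooth functions; each smoothness proof
    below exhibits such a class. *)
Lemma smooth_closed (C : (T -> R) -> Prop) :
  (forall f, C f -> [/\ continuous f,
     forall i x, derivable f x (e_ i) & forall i, C (partial i f)]) ->
  forall f, C f -> smooth f.
Proof.
move=> HC f Cf s.
have : C (foldr partial f s) by elim: s => //= i s ih; have [] := HC _ ih.
by case/HC.
Qed.

Lemma smooth_continuous f : smooth f -> continuous f.
Proof. by move=> /(_ [::])[]. Qed.
Arguments smooth_continuous {f} _.

Lemma smooth_derivable f i x : smooth f -> derivable f x (e_ i).
Proof. by move=> /(_ [::])[_]; exact. Qed.

Lemma smooth_partial f i : smooth f -> smooth (partial i f).
Proof. by move=> sf s; have := sf (rcons s i); rewrite foldr_rcons. Qed.

Lemma smooth_is_derive f i x : smooth f -> is_derive x (e_ i) f (partial i f x).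
Proof. by move=> sf; apply: derivableP; exact: smooth_derivable. Qed.

Lemma smooth_cst (c : R) : smooth (fun _ : T => c).
Proof.
apply: (@smooth_closed [set f | exists c : R, f = fun=> c]); last by exists c.
move=> _ [{}c ->]; split.
- by move=> x; exact: cst_continuous.
- by move=> i x; exact: derivable_cst.
- by move=> i; exists 0; apply/funext => x; rewrite /partial derive_cst.
Qed.

(** The closure of products of smooth functions under the Leibniz rule. *)
Inductive sum_of_smooth_products : (T -> R) -> Prop :=
| SmoothProduct f g : smooth f -> smooth g ->
    sum_of_smooth_products (fun x => f x * g x)
| SmoothSum f g : sum_of_smooth_products f -> sum_of_smooth_products g ->
    sum_of_smooth_products (fun x => f x + g x).

Lemma partialM f g i x : smooth f -> smooth g ->
  is_derive x (e_ i) (fun x => f x * g x)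
    (f x * partial i g x + g x * partial i f x).
Proof.
move=> sf sg.
exact: (is_deriveM (smooth_is_derive i x sf) (smooth_is_derive i x sg)).
Qed.

Lemma smoothM f g : smooth f -> smooth g -> smooth (fun x => f x * g x).
Proof.
move=> sf sg; apply: (smooth_closed _ (SmoothProduct sf sg)) => {f g sf sg} h.
elim=> [f g sf sg|f g Cf [cf df pf] Cg [cg dg pg]]; split.
- move=> x; have := cvgM (smooth_continuous sf x) (smooth_continuous sg x); exact.
- by move=> i x; have [] := partialM i x sf sg.
- move=> i; have -> : partial i (fun x => f x * g x) =
      (fun x => (f x * partial i g x) + (g x * partial i f x)).
    by apply/funext => x; have [_ <-] := partialM i x sf sg.
  exact: (SmoothSum (SmoothProduct sf (smooth_partial i sg))
    (SmoothProduct sg (smooth_partial i sf))).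
- move=> x; have := cvgD (cf x) (cg x); exact.
- by move=> i x; apply: derivableD.
- move=> i; have -> : partial i (fun x => f x + g x) =
      (fun x => partial i f x + partial i g x).
    by apply/funext => x; rewrite /partial deriveD.
  exact: SmoothSum.
Qed.

Lemma smooth_prod (I : Type) (s : seq I) (F : I -> T -> R) :
  (forall i, smooth (F i)) -> smooth (fun x => \prod_(i <- s) F i x).
Proof.
move=> sF; elim: s => [|i s ih].
  have -> : (fun x => \prod_(i <- [::]) F i x) = (fun=> 1).
    by apply/funext => x; rewrite big_nil.
  exact: smooth_cst.
have -> : (fun x => \prod_(j <- i :: s) F j x) =
    (fun x => F i x * \prod_(j <- s) F j x).
  by apply/funext => x; rewrite big_cons.
exact: (smoothM (sF i) ih).
Qed.

Lemma is_derive_affine f (s : R) (a x : T) i : smooth f ->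
  is_derive x (e_ i) (fun x => f (s *: x + a)) (s * partial i f (s *: x + a)).
Proof.
move=> sf; apply/is_derive_line.
have := smooth_is_derive i (s *: x + a) sf.
move=> /is_derive_line h.
have -> : (fun h : R => f (s *: (h *: e_ i + x) + a)) =
    (fun h : R => f (h *: e_ i + (s *: x + a))) \o (fun h : R => s *: h).
  by apply/funext => u /=; rewrite scalerDr scalerA addrA.
rewrite mulrC; apply: is_derive1_comp; first by rewrite scaler0.
refine (@is_derive_eq _ _ _ _ _ _ _ _ (is_deriveZ s (is_derive_id (0 : R) 1)) _).
by rewrite /GRing.scale/= mulr1.
Qed.

Lemma continuous_affine (s : R) (a : T) : continuous (fun x : T => s *: x + a).
Proof.
move=> x; have ha := @cst_continuous T T a x.
have hs := @scaler_continuous R T s x.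
have h := continuousD hs ha; exact: h.
Qed.

Lemma smooth_affine f (s : R) (a : T) : smooth f -> smooth (fun x => f (s *: x + a)).
Proof.
move=> sf.
pose C := [set h : T -> R | exists2 g, smooth g & exists c : R,
  h = fun x => c * g (s *: x + a)].
have Cf : C (fun x => f (s *: x + a)).
  by exists f => //; exists 1; apply/funext => x; rewrite mul1r.
apply: (@smooth_closed C _ _ Cf) => {f sf Cf} _ [g sg [c ->]].
have D i x : is_derive x (e_ i) (fun x => c * g (s *: x + a))
    (c * (s * partial i g (s *: x + a))).
  exact: (is_deriveZ c (is_derive_affine s a x i sg)).
split.
- move=> x; have h1 := @continuous_affine s a x.
  have h2 := continuous_comp h1 (smooth_continuous sg (s *: x + a)).
  have h3 := continuousM (@cst_continuous T R c x) h2; exact: h3.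
- by move=> i x; have [] := D i x.
- move=> i; exists (partial i g); first exact: smooth_partial.
  exists (c * s); apply/funext => x; have [_] := D i x.
  by rewrite /partial => ->; rewrite mulrA.
Qed.

Lemma partial_affine f (s : R) (a : T) i x : smooth f ->
  partial i (fun x => f (s *: x + a)) x = s * partial i f (s *: x + a).
Proof. by move=> sf; have [] := is_derive_affine s a x i sf. Qed.

Lemma smooth_exp_inv (P : {poly R}) (a c : R) (i : 'I_n) :
  smooth (fun x : T => exp_inv P (a * x ord0 i + c)).
Proof.
pose C := [set h : T -> R | exists P : {poly R},
  h = fun x => exp_inv P (a * x ord0 i + c)].
apply: (@smooth_closed C); last by exists P.
move=> _ [{}P ->].
have D j x : is_derive x (e_ j) (fun x : T => exp_inv P (a * x ord0 i + c))
    (exp_inv ('X^2 * (P - P^`())) (a * x ord0 i + c) * (a * (i == j)%:R)).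
  apply/is_derive_line.
  have -> : (fun h : R => exp_inv P (a * (h *: e_ j + x) ord0 i + c)) =
     exp_inv P \o (fun h : R => (a * (i == j)%:R) *: h + (a * x ord0 i + c)).
    apply/funext => h /=; rewrite !mxE eqxx/=; congr exp_inv.
    by rewrite /GRing.scale/=; ring.
  apply: is_derive1_comp.
    by rewrite scaler0 add0r; exact: is_derive_exp_inv.
  refine (@is_derive_eq _ _ _ _ _ _ _ _ (is_deriveD
    (is_deriveZ (a * (i == j)%:R) (is_derive_id (0 : R) 1))
    (is_derive_cst _ (0 : R) 1)) _).
  by rewrite addr0 /GRing.scale/= mulr1.
split.
- move=> x.
  have h1 := continuousM (@cst_continuous T R a x) (@coord_continuous R 1 n ord0 i x).
  have h2 := continuousD h1 (@cst_continuous T R c x).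
  have h3 := continuous_comp h2 (continuous_exp_inv P (a * x ord0 i + c)).
  exact: h3.
- by move=> j x; have [] := D j x.
- move=> j; exists ((a * (i == j)%:R) *: ('X^2 * (P - P^`()))).
  apply/funext => x; have [_] := D j x; rewrite /partial => ->.
  rewrite /exp_inv; case: ifP => _; last by rewrite mul0r.
  by rewrite hornerZ; ring.
Qed.

Lemma closed_norm_le (M : R) : closed [set x : T | `|x| <= M].
Proof.
apply: (@closed_comp _ _ (fun x : T => `|x|) [set t : R | t <= M]).
  by move=> y _; exact: norm_continuous.
exact: closed_le.
Qed.
Arguments closed_norm_le M : clear implicits.

Lemma smooth_test_function f (r : R) : smooth f ->
  (forall x, r < `|x| -> f x = 0) -> test_function f.
Proof.
move=> sf f0; split => //; apply: bounded_closed_compact; last exact: closed_closure.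
exists r; split; [exact: num_real|move=> M rM x].
have cl := closed_norm_le M.
move=> /(@closure_subset _ _ [set x : T | `|x| <= M]).
rewrite -(closure_id _).1//; apply => y /= fy.
by rewrite leNgt; apply: contra fy => My; rewrite f0// (lt_trans rM).
Qed.

Lemma partial_support f (r : R) i : (forall x, r < `|x| -> f x = 0) ->
  forall x, r < `|x| -> partial i f x = 0.
Proof.
move=> f0 x rx; rewrite /partial (@near_eq_derive _ _ _ f (cst 0)) ?derive_cst//.
have : \forall y \near x, r < `|y|.
  exact: (@norm_continuous _ T x [set t : R | r < t] (lt_nbhsr rx)).
by apply: filterS => y; exact: f0.
Qed.

Lemma continuous_support_bounded f (r : R) : continuous f ->
  (forall x, r < `|x| -> f x = 0) -> exists2 M, 0 <= M & forall x, `|f x| <= M.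
Proof.
move=> cf f0.
have cK : compact [set x : T | `|x| <= r].
  apply: bounded_closed_compact.
    by exists r; split; [exact: num_real|]; move=> M rM x /= xr; rewrite (le_trans xr)// ltW.
  exact: closed_norm_le.
have := compact_bounded (continuous_compact (continuous_subspaceT cf) cK).
move=> [M [_ hM]]; exists (`|M| + 1); first by rewrite addr_ge0.
move=> x; have [xr|xr] := leP `|x| r.
  apply: (hM (`|M| + 1)); first by rewrite (le_lt_trans (ler_norm M))// ltrDl.
  by exists x.
by rewrite f0// normr0 addr_ge0.
Qed.

(** The product form keeps smoothness within the class of the functions exp_inv
    composed with affine maps of one coordinate. *)
Definition bump_rV (x : T) : R :=
  \prod_(i < n) (exp_inv 1 (1 - x ord0 i) * exp_inv 1 (1 + x ord0 i)).

Lemma smooth_bump : smooth bump_rV.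
Proof.
apply: smooth_prod => i; apply: smoothM.
  have -> : (fun x : T => exp_inv 1 (1 - x ord0 i)) =
      (fun x : T => exp_inv 1 (-1 * x ord0 i + 1)).
    by apply/funext => x; rewrite mulN1r addrC.
  exact: smooth_exp_inv.
have -> : (fun x : T => exp_inv 1 (1 + x ord0 i)) =
    (fun x : T => exp_inv 1 (1 * x ord0 i + 1)).
  by apply/funext => x; rewrite mul1r addrC.
exact: smooth_exp_inv.
Qed.

Lemma bump_ge0 x : 0 <= bump_rV x.
Proof. by apply: prodr_ge0 => i _; rewrite mulr_ge0// exp_inv_ge0. Qed.

Lemma bump_le1 x : bump_rV x <= 1.
Proof.
rewrite -[leRHS](expr1n _ n) -[X in _ ^+ X]card_ord -prodr_const.
apply: ler_prod => i _.
by rewrite mulr_ge0 ?mulr_ile1 ?exp_inv_ge0 ?exp_inv_le1.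
Qed.

Lemma bump_support x : 1 < `|x| -> bump_rV x = 0.
Proof.
move=> x1; have [i xi] : exists i, 1 <= `|x ord0 i|.
  apply: contrapT => /forallNP h; move: x1; rewrite ltNge => /negP; apply.
  apply: ltW; apply/(normr_rV_lt x ltr01) => i.
  by rewrite ltNge; apply/negP; exact: h.
rewrite /bump_rV (bigD1 i)//=; move: xi; rewrite lter_normr => /orP[xi|xi].
  rewrite [exp_inv 1 (1 - _)]/exp_inv ifF ?mul0r//.
  by apply/negbTE; rewrite -leNgt subr_le0.
rewrite [exp_inv 1 (1 + _)]/exp_inv ifF ?mulr0 ?mul0r//.
by apply/negbTE; rewrite -leNgt -[x ord0 i]opprK subr_le0.
Qed.

Lemma bump_half x : `|x| < 2^-1 -> expR (- 2) ^+ (2 * n) <= bump_rV x.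
Proof.
move=> x2; rewrite exprM -[X in _ ^+ X]card_ord -prodr_const.
apply: ler_prod => i _; rewrite exprn_ge0 ?expR_ge0//= expr2.
have : `|x ord0 i| < 2^-1 by rewrite (le_lt_trans _ x2)// normr_coord_le.
rewrite ltr_norml => /andP[h1 h2].
by apply: ler_pM; rewrite ?expR_ge0// exp_inv_half//; lra.
Qed.

End smooth.

(** * Regularisation *)

Section regularisation.
Context {R : realType} {n : nat}.
Local Notation mu := (lebesgue_rV n).
Local Notation T := 'rV[R]_n.
Local Notation e_ i := (delta_mx ord0 i : T).
Implicit Types (f h Psi : T -> R).

Lemma is_derive_line_at f x v (t d : R) :
  is_derive (t *: v + x) v f d -> is_derive t 1 (fun u : R => f (u *: v + x)) d.
Proof.
move=> /is_derive_line h; rewrite -[d]mulr1.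
have -> : (fun u : R => f (u *: v + x)) =
    (fun u : R => f (u *: v + (t *: v + x))) \o (fun u : R => u - t).
  by apply/funext => u /=; rewrite addrA -scalerDl subrK.
apply: is_derive1_comp; first by rewrite subrr.
refine (@is_derive_eq _ _ _ _ _ _ _ _ (is_deriveD (is_derive_id t 1)
    (is_derive_cst (- t) t 1)) _).
by rewrite addr0.
Qed.

Lemma integrable_ball_indic (M K : R) :
  mu.-integrable setT (EFin \o (fun y : T => M * \1_[set y : T | `|y| < K] y)).
Proof.
have [K0|K0] := ltP 0 K; last first.
  rewrite (_ : _ \o _ = cst 0%E); first exact: integrable0.
  apply/funext => y /=; rewrite indicE memNset ?mulr0//= => yK.
  by have := lt_le_trans yK K0; rewrite normr_lt0.
have mB : measurable [set y : T | `|y| < K] := measurable_ball0_rV K0.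
rewrite (_ : _ \o _ = (fun y => M%:E * (\1_[set y : T | `|y| < K] y)%:E)%E).
  apply: integrableZl => //; apply/integrableP; split; first exact/measurable_EFinP.
  rewrite (eq_integral (fun y => (\1_[set y : T | `|y| < K] y)%:E)).
    rewrite integral_indic// setIT.
    by apply: (@le_lt_trans _ _ ((2 * K) ^+ n)%:E); rewrite ?ltry// -lebesgue_rV_ball.
  by move=> y _; rewrite gee0_abs// lee_fin.
by apply/funext => y /=; rewrite EFinM.
Qed.

Lemma integrable_continuous_support f (r : R) : continuous f ->
  (forall x, r < `|x| -> f x = 0) -> mu.-integrable setT (EFin \o f).
Proof.
move=> cf f0; have [M M0 fM] := continuous_support_bounded cf f0.
apply: (le_integrable measurableT _ _ (integrable_ball_indic M (r + 1))) => //.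
  by apply/measurable_EFinP; exact: (continuous_measurable_rV cf).
move=> x _ /=; rewrite lee_fin indicE.
have [xr|xr] := ltP `|x| (r + 1).
  by rewrite mem_set//= mulr1 (le_trans (fM x))// ler_norm.
by rewrite f0 ?normr0// (lt_le_trans _ xr)// ltrDl.
Qed.

(** Correlation with a kernel; using the kernel at y - x rather than x - y makes
    invariance of the measure under translations suffice everywhere. *)
Definition correlation f Psi (x : T) : R := \int[mu]_y (f y * Psi (y - x)).

Lemma correlationE f Psi x : measurable_fun setT f -> measurable_fun setT Psi ->
  correlation f Psi x = \int[mu]_z (f (x + z) * Psi z).
Proof.
move=> mf mPsi; rewrite /correlation.
rewrite -(@Rintegral_translate _ _ x (fun y => f y * Psi (y - x))).
  by apply: eq_Rintegral => z _; rewrite addrK addrC.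
apply: measurable_funM => //.
exact: (measurable_fun_translate (- x) mPsi).
Qed.

Section smooth_kernel.
Variables (f : T -> R) (cf : continuous f).

Lemma continuous_subr Psi (x : T) :
  continuous Psi -> continuous (fun y : T => Psi (y - x)).
Proof.
move=> cPsi; have -> : (fun y : T => Psi (y - x)) = (fun y : T => Psi (1 *: y - x)).
  by apply/funext => y; rewrite scale1r.
move=> y; have h := continuous_comp (@continuous_affine R n 1 (- x) y) (cPsi _).
exact: h.
Qed.

Lemma shift_support Psi (r K : R) (x : T) : (forall z, r < `|z| -> Psi z = 0) ->
  `|x| <= K -> forall y, r + K < `|y| -> Psi (y - x) = 0.
Proof.
move=> P0 xK y hy; apply: P0; rewrite -(ltrD2r `|x|).
rewrite (le_lt_trans _ (lt_le_trans hy _)) ?lerD2l//.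
by rewrite -[in leLHS](subrK x y) ler_normD.
Qed.

Lemma integrable_correlation Psi (r : R) x : continuous Psi ->
  (forall z, r < `|z| -> Psi z = 0) ->
  mu.-integrable setT (EFin \o (fun y => f y * Psi (y - x))).
Proof.
move=> cPsi P0; apply: (@integrable_continuous_support _ (r + `|x|)).
  move=> y; have := continuousM (@cf y) (@continuous_subr _ x cPsi y); exact.
by move=> y hy; rewrite (shift_support P0 (lexx _) hy) mulr0.
Qed.

Lemma ball_bound (K : R) : exists2 M, 0 <= M & forall y : T, `|y| < K -> `|f y| <= M.
Proof.
have cK : compact [set x : T | `|x| <= K].
  apply: bounded_closed_compact; last exact: closed_norm_le.
  by exists K; split; [exact: num_real|move=> M rM x /= xr; rewrite (le_trans xr)// ltW].
have := compact_bounded (continuous_compact (continuous_subspaceT cf) cK).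
move=> [M [_ hM]]; exists (`|M| + 1); first by rewrite addr_ge0.
move=> y /ltW yK; apply: (hM (`|M| + 1)).
  by rewrite (le_lt_trans (ler_norm M))// ltrDl.
by exists y.
Qed.

(** Differentiation under the integral sign along the line x + t e_i, |t| < 1:
    for all these t the integrands are supported in one ball of radius K. *)
Lemma is_derive_correlation Psi (r : R) i x : smooth Psi ->
  (forall z, r < `|z| -> Psi z = 0) ->
  is_derive x (e_ i) (correlation f Psi) (- correlation f (partial i Psi) x).
Proof.
move=> sP P0; apply/is_derive_line.
pose F (t : R) (y : T) := f y * Psi (y - (t *: e_ i + x)).
have dF (t : R) (y : T) : is_derive t 1 (F^~ y) (- (f y * partial i Psi (y - (t *: e_ i + x)))).
  have h := is_derive_line_at (is_derive_affine (-1) y (t *: e_ i + x) i sP).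
  have := is_deriveZ (f y) h; rewrite !scaleN1r ![- _ + y]addrC => h'.
  rewrite (_ : F^~ y = (f y \*: (fun u => Psi (- 1 *: (u *: e_ i + x) + y)))).
    refine (@is_derive_eq _ _ _ _ _ _ _ _ h' _).
    by rewrite /GRing.scale/= mulN1r mulrN.
  by apply/funext => u; rewrite /F /= scaleN1r [- _ + y]addrC.
have d1F (t : R) (y : T) : partial1of2 F t y = - (f y * partial i Psi (y - (t *: e_ i + x))).
  by rewrite partial1of2E; have [_ <-] := dF t y.
have sdP := smooth_partial i sP.
have dP0 := partial_support i P0.
have [M M0 hM] := continuous_support_bounded (smooth_continuous sdP) dP0.
pose K : R := r + (1 + `|x|) + 1.
have [N N0 hN] := ball_bound K.
have e1 : `|e_ i : T| <= 1.
  apply/ler_addgt0Pr => e e0; apply/ltW/normr_rV_lt => [|j].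
    by rewrite ltr_wpDl.
  by rewrite mxE eqxx/=; case: eqP => _ /=; rewrite ?normr1 ?normr0 ?ltrDl// ltr_wpDl.
have I0 : [set` `](-1 : R), 1[] 0 by rewrite /= in_itv/= ltrN10 ltr01.
have intF (t : R) : [set` `](-1 : R), 1[] t -> mu.-integrable setT (EFin \o F t).
  by move=> _; apply: integrable_correlation P0; exact: smooth_continuous.
have derF (t : R) (y : T) : [set` `](-1 : R), 1[] t -> setT y -> derivable (F^~ y) t 1.
  by move=> _ _; have [] := dF t y.
pose G (y : T) : R := (N * M) * \1_[set y : T | `|y| < K] y.
have G0 y : 0 <= G y by rewrite !mulr_ge0.
have FG (t : R) (y : T) : [set` `](-1 : R), 1[] t -> setT y -> `|partial1of2 F t y| <= G y.
  rewrite /= in_itv/= -ltr_norml => t1 _; rewrite d1F normrN.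
  have [yK|yK] := ltP `|y| K.
    by rewrite /G indicE mem_set//= mulr1 normrM ler_pM// hN.
  rewrite (@shift_support (partial i Psi) r (1 + `|x|)) ?mulr0 ?normr0//.
    rewrite (le_trans (ler_normD _ _))// lerD2r normrZ.
    by rewrite -[leRHS]mulr1 ler_pM// ltW.
  by rewrite (lt_le_trans _ yK)// ltrDl.
have iG : mu.-integrable setT (EFin \o G) by exact: integrable_ball_indic.
have D1 := derivable_under_integral measurableT I0 intF derF G0 iG FG.
have D2 := differentiation_under_integral measurableT I0 intF derF G0 iG FG.
rewrite (_ : (fun t => correlation f Psi (t *: e_ i + x)) =
  (fun t => \int[mu]_(y in setT) F t y))//.
apply: DeriveDef => //; rewrite -derive1E D2.
rewrite (_ : - _ = \int[mu]_y (- (f y * partial i Psi (y - x)))).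
  by apply: eq_Rintegral => y _; rewrite d1F scale0r add0r.
rewrite /correlation -[LHS]mulN1r -RintegralZl//.
  by apply: eq_Rintegral => y _; rewrite mulN1r.
apply: integrable_correlation dP0; exact: smooth_continuous.
Qed.

(** Dominated convergence along a sequence contradicting continuity; the shifted
    kernels have their supports in one ball of radius K. *)
Lemma continuous_correlation Psi (r : R) : continuous Psi ->
  (forall z, r < `|z| -> Psi z = 0) -> continuous (correlation f Psi).
Proof.
move=> cP P0.
suff H (x : T) : correlation f Psi w @[w --> x] --> correlation f Psi x.
  by move=> x; exact: H.
apply: contrapT => ncvg.
have [e e0 he] : exists2 e : R, 0 < e & forall k : nat, exists w : T,
    `|w - x| < k.+1%:R^-1 /\ e <= `|correlation f Psi x - correlation f Psi w|.
  apply: contrapT => H; apply: ncvg => U /nbhs_ballP[e /= e0 eU].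
  apply: contrapT => ne; apply: H; exists e => // k; apply: contrapT => hk.
  apply: ne; apply/nbhs_ballP; exists k.+1%:R^-1; first by rewrite /= invr_gt0 ltr0n.
  move=> w; rewrite mx_norm_ball /ball_ /= => xw; apply: eU.
  rewrite /ball/= ltNge; apply/negP => ew.
  by apply: hk; exists w; split => //; rewrite distrC.
have [w hw] := choice he.
have [M M0 hM] := continuous_support_bounded cP P0.
pose K : R := r + (1 + `|x|) + 1.
have [N N0 hN] := ball_bound K.
have cvgw : w k @[k --> \oo] --> x.
  apply/cvgrPdist_lt => d d0; near=> k.
  rewrite distrC (lt_trans (hw k).1)//; near: k.
  exact: near_infty_natSinv_lt (PosNum d0).
have mF y : measurable_fun setT (fun z => f z * Psi (z - y)).
  by apply: continuous_measurable_rV => z; have := continuousM (@cf z) (@continuous_subr _ y cP z); exact.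
have D : (\int[mu]_y (f y * Psi (y - w k))%:E)%E @[k --> \oo] -->
    (\int[mu]_y (f y * Psi (y - x))%:E)%E.
  apply: (@dominated_cvg _ T R mu setT measurableT
    (fun k y => (f y * Psi (y - w k))%:E) (fun y => (f y * Psi (y - x))%:E)
    (fun y => ((N * M) * \1_[set y : T | `|y| < K] y)%:E)).
  - by move=> k; apply/measurable_EFinP.
  - move=> y _; apply: cvg_EFin; first exact: nearW.
    apply: cvgM; first exact: cvg_cst.
    have h1 := continuous_comp (@continuous_affine R n (-1) y x) (cP _).
    have h2 := cvg_comp w _ cvgw h1.
    have E (z : T) : (Psi \o (fun x => -1 *: x + y)) z = Psi (y - z).
      by rewrite /= scaleN1r addrC.
    by rewrite -E; under eq_fun do rewrite -E; exact: h2.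
  - by [].
  - exact: integrable_ball_indic.
  - move=> k y _ /=; rewrite lee_fin.
    have [yK|yK] := ltP `|y| K.
      by rewrite indicE mem_set//= mulr1 normrM ler_pM// hN.
    rewrite (@shift_support Psi r (1 + `|x|)) ?mulr0 ?normr0 ?mulr_ge0//.
      rewrite -[w k](subrK x) (le_trans (ler_normD _ _))// lerD2r.
      rewrite (le_trans (ltW (hw k).1))// invf_le1 ?ltr0n// ler1n//.
    by rewrite (lt_le_trans _ yK)// ltrDl.
have ix := integrable_correlation x cP P0.
have {}D : correlation f Psi (w k) @[k --> \oo] --> correlation f Psi x.
  rewrite /correlation /Rintegral; apply: fine_cvg; rewrite fineK//.
  exact: integrable_fin_num.
have /cvgrPdist_lt/(_ e e0) [k _ /(_ k (leqnn k))] := D.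
by rewrite ltNge (hw k).2.
Unshelve. all: by end_near. Qed.

End smooth_kernel.
Arguments is_derive_correlation {f} cf {Psi r} i x.

(** Derivatives fall on the kernel, which is smooth; hence so is the
    regularisation of a merely continuous function. *)
Lemma smooth_correlation f Psi (r : R) : continuous f -> smooth Psi ->
  (forall z, r < `|z| -> Psi z = 0) -> smooth (correlation f Psi).
Proof.
move=> cf sP P0.
pose C := [set h : T -> R | exists Psi, [/\ smooth Psi,
  forall z, r < `|z| -> Psi z = 0 & h = correlation f Psi]].
apply: (@smooth_closed _ _ C); last by exists Psi.
move=> _ [{sP P0}Psi [sP P0 ->]]; split.
- exact: (continuous_correlation cf (smooth_continuous sP) P0).
- by move=> i x; have [] := is_derive_correlation cf i x sP P0.
- move=> i; exists (fun y => -1 * partial i Psi y); split.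
  + by apply: smoothM; [exact: smooth_cst|exact: smooth_partial].
  + by move=> z rz; rewrite (partial_support i P0 rz) mulr0.
  + apply/funext => x; have [_] := is_derive_correlation cf i x sP P0.
    rewrite /partial => ->; rewrite /correlation -[LHS]mulN1r -RintegralZl//.
      by apply: eq_Rintegral => y _; rewrite mulrCA.
    exact: (integrable_correlation cf x (smooth_continuous (smooth_partial i sP))
      (partial_support i P0)).
Qed.

(** The shifted kernel is itself a test function, so the definition of the weak
    gradient moves the derivative from the kernel back to f. *)
Lemma partial_correlation f g Psi (r : R) i x : continuous f ->
  is_weak_gradient f g -> smooth Psi -> (forall z, r < `|z| -> Psi z = 0) ->
  partial i (correlation f Psi) x = correlation (fun y => g y ord0 i) Psi x.
Proof.
move=> cf [_ _ wg] sP P0.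
have [_] := is_derive_correlation cf i x sP P0; rewrite /partial => ->.
have E (y : T) : 1 *: y + - x = y - x by rewrite scale1r.
have tP : test_function (fun y => Psi (y - x)).
  have := smooth_affine 1 (- x) sP; under eq_fun do rewrite E; move=> sPx.
  exact: (smooth_test_function sPx (shift_support P0 (lexx `|x|))).
transitivity (- \int[mu]_y (f y * partial i (fun y => Psi (y - x)) y)); last first.
  by rewrite (wg _ i tP) opprK.
apply: (congr1 -%R); apply: eq_Rintegral => y _; apply: (congr1 ( *%R (f y))).
have h := partial_affine 1 (- x) i y sP; rewrite mul1r E in h.
apply: (etrans (esym h)).
by under eq_fun do rewrite E.
Qed.

End regularisation.

(** * The p-Laplace flux *)

Section young.
Context {R : realType} (p : R) (p1 : 1 < p).

(** Compare b with d a. Keeping the power p - 1 of the first factor, instead of a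
    conjugate exponent, avoids any duality of L^p spaces later on. *)
Lemma young_powR (a b d : R) : 0 <= a -> 0 <= b -> 0 < d ->
  a `^ (p - 1) * b <= d * a `^ p + (d `^ (p - 1))^-1 * b `^ p.
Proof.
move=> a0 b0 d0; have p0 : 0 < p by rewrite (lt_trans _ p1).
have dp0 : 0 < d `^ (p - 1) by rewrite powR_gt0.
have [bda|dab] := leP b (d * a).
  apply: (@le_trans _ _ (d * a `^ p)).
    by rewrite -(mulr_powRB1 a0 p0) mulrA mulrC ler_wpM2r ?powR_ge0.
  by rewrite lerDl mulr_ge0 ?invr_ge0 ?powR_ge0.
apply: (@le_trans _ _ ((d `^ (p - 1))^-1 * b `^ p)); last first.
  by rewrite lerDr mulr_ge0 ?powR_ge0// ltW.
rewrite ler_pdivlMl// mulrA -powRM// ?(ltW d0)//.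
rewrite -(mulr_powRB1 b0 p0) mulrC ler_wpM2l//.
by apply: ge0_ler_powR; rewrite ?nnegrE ?mulr_ge0 ?subr_ge0// ?(ltW d0)// ltW.
Qed.

Lemma young_powR1 (a b : R) : 0 <= a -> 0 <= b ->
  a `^ (p - 1) * b <= a `^ p + b `^ p.
Proof.
move=> a0 b0; have := young_powR a0 b0 ltr01.
by rewrite powR1 invr1 !mul1r.
Qed.

Lemma le_1DpowR (b : R) : 0 <= b -> b <= 1 + b `^ p.
Proof. by move=> b0; have := young_powR1 ler01 b0; rewrite !powR1 mul1r. Qed.

End young.

Section flux.
Context {R : realType} {n : nat} (p : R) (p1 : 1 < p).
Implicit Types v w : 'rV[R]_n.

(** The integrand of the p-energy form, for arbitrary vectors. *)
Definition flux_dot v w := enorm v `^ (p - 2) * dot v w.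

Lemma dot_ge0 v : 0 <= dot v v.
Proof. by apply: sumr_ge0 => i _; rewrite -expr2 sqr_ge0. Qed.

Lemma enorm_ge0 v : 0 <= enorm v. Proof. exact: sqrtr_ge0. Qed.

Lemma enorm_sqr v : enorm v ^+ 2 = dot v v.
Proof. by rewrite sqr_sqrtr// dot_ge0. Qed.

Lemma coord_le_enorm v i : `|v ord0 i| <= enorm v.
Proof.
rewrite -sqrtr_sqr ler_wsqrtr// /dot (bigD1 i)//= -expr2 lerDl.
by apply: sumr_ge0 => j _; rewrite -expr2 sqr_ge0.
Qed.

Lemma enorm_le_sum v : enorm v <= \sum_i `|v ord0 i|.
Proof.
have s0 : 0 <= \sum_i `|v ord0 i| by apply: sumr_ge0.
rewrite -[leRHS]ger0_norm// -sqrtr_sqr ler_wsqrtr// expr2 mulr_suml /dot.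
apply: ler_sum => i _; rewrite -expr2 -real_normK ?num_real// expr2 ler_wpM2l//.
by rewrite (bigD1 i)//= lerDl sumr_ge0.
Qed.

Lemma flux_dot_le v w :
  `|flux_dot v w| <= \sum_i enorm v `^ (p - 1) * `|w ord0 i|.
Proof.
rewrite /flux_dot normrM ger0_norm ?powR_ge0// -mulr_sumr.
rewrite -(mulr_powRB1 (enorm_ge0 v) (_ : 0 < p - 1)) ?subr_gt0//.
rewrite (_ : p - 1 - 1 = p - 2); last by ring.
rewrite [enorm v * _]mulrC -mulrA ler_wpM2l ?powR_ge0// mulr_sumr.
rewrite (le_trans (ler_norm_sum _ _ _))//; apply: ler_sum => i _.
by rewrite normrM ler_wpM2r// coord_le_enorm.
Qed.

Lemma flux_dot_self v : flux_dot v v = enorm v `^ p.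
Proof.
rewrite /flux_dot -enorm_sqr expr2 mulrA [_ * enorm v]mulrC.
rewrite (_ : p - 2 = p - 1 - 1); last by ring.
rewrite [_ * enorm v]mulrC mulr_powRB1 ?enorm_ge0 ?subr_gt0//.
by rewrite mulr_powRB1 ?enorm_ge0// (lt_trans _ p1).
Qed.

End flux.

Section flux_field.
Context {R : realType} {n : nat} (p : R) (p1 : 1 < p).
Local Notation mu := (lebesgue_rV n).
Local Notation T := 'rV[R]_n.
Let p0 : 0 < p. Proof. exact: lt_trans p1. Qed.

Lemma pmass_lty_integrable (h : T -> R) : measurable_fun setT h ->
  (pmass p h < +oo)%E -> mu.-integrable setT (fun x => (`|h x| `^ p)%:E).
Proof.
move=> mh hoo; apply/integrableP; split; first exact: (measurable_pmass p mh).
apply: le_lt_trans hoo; rewrite le_eqVlt; apply/orP; left; apply/eqP.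
by apply: eq_integral => x _; rewrite gee0_abs// lee_fin powR_ge0.
Qed.

Lemma pmass_le (h k : T -> R) : measurable_fun setT h -> measurable_fun setT k ->
  (forall x, `|h x| <= `|k x|) -> (pmass p h <= pmass p k)%E.
Proof.
move=> mh mk hk; apply: ge0_le_integral => //.
- exact: (measurable_pmass p mh).
- exact: (measurable_pmass p mk).
- by move=> x _; rewrite lee_fin; apply: ge0_ler_powR; rewrite ?nnegrE ?(ltW p0).
Qed.

Lemma pmass_sum_lty (I : Type) (s : seq I) (h : I -> T -> R) :
  (forall i, measurable_fun setT (h i)) -> (forall i, pmass p (h i) < +oo)%E ->
  (pmass p (fun x => \sum_(i <- s) h i x)%R < +oo)%E.
Proof.
move=> mh hoo; elim: s => [|i s ih].
  rewrite /pmass (eq_integral (cst 0%E)) ?integral0 ?ltry//.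
  by move=> x _; rewrite big_nil normr0 powR0// lt0r_neq0.
rewrite (_ : (fun x => _) = (fun x => h i x + \sum_(j <- s) h j x)); last first.
  by apply/funext => x; rewrite big_cons.
apply: le_lt_trans (pmassD_le p0 (mh i) _) _.
  exact: measurable_sum.
by rewrite lte_mul_pinfty ?lee_fin ?powR_ge0// lte_add_pinfty.
Qed.

Variable g : T -> T.
Hypothesis mg : forall i, measurable_fun setT (fun x => g x ord0 i).
Hypothesis goo : forall i, (pmass p (fun x => g x ord0 i) < +oo)%E.

Local Notation G := (fun x => enorm (g x)).

Lemma measurable_enorm : measurable_fun setT G.
Proof.
rewrite (_ : G = (fun x => (\sum_i g x ord0 i * g x ord0 i) `^ 2^-1)).
  apply: (measurableT_comp (measurable_powR _)).
  by apply: measurable_sum => i; exact: measurable_funM.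
by apply/funext => x; rewrite powR12_sqrt//; exact: dot_ge0.
Qed.

Lemma pmass_enorm_lty : (pmass p G < +oo)%E.
Proof.
apply: (@le_lt_trans _ _ (pmass p (fun x => \sum_i `|g x ord0 i|)%R)).
  apply: pmass_le.
  - exact: measurable_enorm.
  - apply: measurable_sum => i.
    exact: (measurableT_comp (@normr_measurable R setT) (mg i)).
  - move=> x; rewrite !ger0_norm ?enorm_ge0 ?enorm_le_sum//.
    by apply: sumr_ge0.
apply: pmass_sum_lty => i.
  exact: (measurableT_comp (@normr_measurable R setT) (mg i)).
apply: le_lt_trans (goo i); apply: pmass_le => //.
  exact: (measurableT_comp (@normr_measurable R setT) (mg i)).
by move=> x; rewrite normr_id.
Qed.

Lemma measurable_flux_dot (w : T -> T) :
  (forall i, measurable_fun setT (fun x => w x ord0 i)) ->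
  measurable_fun setT (fun x => flux_dot p (g x) (w x)).
Proof.
move=> mw; apply: measurable_funM.
  exact: (measurableT_comp (measurable_powR _) measurable_enorm).
by apply: measurable_sum => i; apply: measurable_funM.
Qed.

Lemma integrable_flux_dot (w : T -> T) (D : T -> R) :
  (forall i, measurable_fun setT (fun x => w x ord0 i)) ->
  mu.-integrable setT (EFin \o D) ->
  (forall x, \sum_i enorm (g x) `^ (p - 1) * `|w x ord0 i| <= D x) ->
  mu.-integrable setT (EFin \o (fun x => flux_dot p (g x) (w x))).
Proof.
move=> mw iD wD; apply: (le_integrable measurableT _ _ iD).
  by apply/measurable_EFinP; exact: measurable_flux_dot.
move=> x _ /=; rewrite lee_fin (le_trans (flux_dot_le p1 _ _))//.
by rewrite (le_trans (wD x))// ler_norm.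
Qed.

Lemma Rintegral_flux_dot_le (w : T -> T) (D : T -> R) :
  (forall i, measurable_fun setT (fun x => w x ord0 i)) ->
  mu.-integrable setT (EFin \o D) ->
  (forall x, \sum_i enorm (g x) `^ (p - 1) * `|w x ord0 i| <= D x) ->
  `|\int[mu]_x flux_dot p (g x) (w x)| <= \int[mu]_x D x.
Proof.
move=> mw iD wD; have iw := integrable_flux_dot mw iD wD.
apply: (le_trans (le_normr_Rintegral measurableT iw)).
apply: le_Rintegral => //.
  exact: (integrable_norm iw).
by move=> x _; rewrite (le_trans (flux_dot_le p1 _ _)).
Qed.

End flux_field.

Section scaled_bump.
Context {R : realType} {n : nat}.
Local Notation mu := (lebesgue_rV n).
Local Notation T := 'rV[R]_n.

(** Large s gives a regularising kernel, small s a cut-off function. *)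
Definition scaled_bump (s : R) (x : T) : R := bump_rV (s *: x).

Lemma smooth_scaled_bump s : smooth (scaled_bump s).
Proof.
have := smooth_affine s (0 : T) (@smooth_bump R n).
by under eq_fun do rewrite addr0.
Qed.

Lemma partial_scaled_bump s i (x : T) :
  partial i (scaled_bump s) x = s * partial i bump_rV (s *: x).
Proof.
have := partial_affine s (0 : T) i x (@smooth_bump R n).
by under eq_fun do rewrite addr0; rewrite addr0.
Qed.

Lemma scaled_bump_support s (x : T) : 0 < s -> s^-1 < `|x| -> scaled_bump s x = 0.
Proof.
move=> s0 sx; apply: bump_support; rewrite normrZ gtr0_norm//.
by rewrite -ltr_pdivrMl// mulr1.
Qed.

Lemma scaled_bump_ge0 s (x : T) : 0 <= scaled_bump s x.
Proof. exact: bump_ge0. Qed.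

Lemma test_scaled_bump s : 0 < s -> test_function (scaled_bump s).
Proof.
move=> s0; apply: (@smooth_test_function _ _ _ s^-1); first exact: smooth_scaled_bump.
by move=> x; exact: scaled_bump_support.
Qed.

Lemma integrable_scaled_bump s : 0 < s ->
  mu.-integrable setT (EFin \o scaled_bump s).
Proof.
move=> s0; apply: (@integrable_continuous_support _ _ _ s^-1).
  exact/smooth_continuous/smooth_scaled_bump.
by move=> x; exact: scaled_bump_support.
Qed.

Lemma Rintegral_ball_indic (M K : R) : 0 < K ->
  \int[mu]_x (M * \1_[set y : T | `|y| < K] x) = M * (2 * K) ^+ n.
Proof.
move=> K0.
have mB : measurable [set y : T | `|y| < K] := measurable_ball0_rV K0.
rewrite RintegralZl//.
  apply: (congr1 ( *%R M)); rewrite /Rintegral integral_indic// setIT.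
  exact: (congr1 fine (lebesgue_rV_ball n K0)).
have := @integrable_ball_indic R n 1 K.
by apply: eq_integrable => // x _ /=; rewrite mul1r.
Qed.

Lemma Rintegral_scaled_bump_ge s : 0 < s ->
  expR (- 2) ^+ (2 * n) * s^-1 ^+ n <= \int[mu]_x scaled_bump s x.
Proof.
move=> s0; have h0 : 0 < (2 * s)^-1 by rewrite invr_gt0 mulr_gt0.
apply: (@le_trans _ _ (\int[mu]_x (expR (- 2) ^+ (2 * n) *
    \1_[set y : T | `|y| < (2 * s)^-1] x))).
  by rewrite Rintegral_ball_indic// invfM mulVKf.
apply: le_Rintegral => //.
- exact: integrable_ball_indic.
- exact: integrable_scaled_bump.
move=> x _; rewrite indicE.
have [xs|xs] := ltP `|x| (2 * s)^-1; last first.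
  by rewrite memNset ?mulr0 ?scaled_bump_ge0//= => /(le_lt_trans xs); rewrite ltxx.
rewrite mem_set//= mulr1; apply: bump_half.
by rewrite normrZ gtr0_norm// -ltr_pdivlMl// -invfM mulrC.
Qed.

Lemma Rintegral_scaled_bump_gt0 s : 0 < s -> 0 < \int[mu]_x scaled_bump s x.
Proof.
move=> s0; apply: lt_le_trans (Rintegral_scaled_bump_ge s0).
by rewrite mulr_gt0// exprn_gt0 ?expR_gt0 ?invr_gt0.
Qed.

Lemma partial_bump_bound :
  exists2 M : R, 0 <= M & forall i (x : T), `|partial i bump_rV x| <= M.
Proof.
have h i : exists M : R, forall x : T, `|partial i bump_rV x| <= M.
  have [M M0 hM] := continuous_support_bounded
    (smooth_continuous (smooth_partial i (@smooth_bump R n)))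
    (partial_support i (@bump_support R n)).
  by exists M.
have [M hM] := choice h.
exists (\sum_i `|M i|); first exact: sumr_ge0.
move=> i x; rewrite (le_trans (hM i x))// (le_trans (ler_norm _))//.
by rewrite (bigD1 i)//= lerDl sumr_ge0.
Qed.

End scaled_bump.

Section tension.
Context {R : realType} {n : nat} (p : R) (p1 : 1 < p).
Local Notation mu := (lebesgue_rV n).
Local Notation T := 'rV[R]_n.
Let p0 : 0 < p. Proof. exact: lt_trans p1. Qed.

(** Test with the bump function dilated by 1/s, s <= 1. Its integral is at least
    of order s^(-n), while by Young's inequality the energy form is at most of
    order s + s^(1-n); hence c = O(s). *)
Lemma p_tension_constant_eq0 (f : T -> R) (c : R) :
  (forall i, measurable_fun setT (fun x => grad f x ord0 i)) ->
  (forall i, pmass p (fun x => grad f x ord0 i) < +oo)%E ->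
  p_tension p f c -> c = 0.
Proof.
move=> mg goo tc; set g := grad f in mg goo *.
pose G x := enorm (g x).
have mG : measurable_fun setT G := measurable_enorm mg.
have Goo := pmass_enorm_lty p1 mg goo.
have iG := pmass_lty_integrable mG Goo.
pose E := \int[mu]_x (`|G x| `^ p).
have E0 : 0 <= E by apply: Rintegral_ge0 => x _; exact: powR_ge0.
have [M M0 hM] := @partial_bump_bound R n.
pose K := n%:R * E + n%:R * M `^ p * 4 ^+ n.
have K0 : 0 <= K by rewrite addr_ge0// !mulr_ge0// ?powR_ge0 ?exprn_ge0.
pose k0 : R := expR (- 2) ^+ (2 * n).
have k00 : 0 < k0 by rewrite exprn_gt0 ?expR_gt0.
have key s : 0 < s -> s <= 1 -> `|c| * k0 <= s * K.
  move=> s0 s1.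
  have sn0 : 0 < s ^+ n by rewrite exprn_gt0.
  pose w x := nabla (scaled_bump s) x : T.
  have wE x i : w x ord0 i = s * partial i bump_rV (s *: x).
    by rewrite /w mxE partial_scaled_bump.
  have mw i : measurable_fun setT (fun x => w x ord0 i).
    rewrite (_ : (fun x => _) = partial i (scaled_bump s)).
      exact: (continuous_measurable_rV
        (smooth_continuous (smooth_partial i (smooth_scaled_bump s)))).
    by apply/funext => x; rewrite /w mxE.
  pose B := [set y : T | `|y| < 2 / s].
  pose D x := s * n%:R * `|G x| `^ p + s * n%:R * M `^ p * \1_B x.
  have iD1 : mu.-integrable setT (EFin \o (fun x => s * n%:R * `|G x| `^ p)).
    rewrite (_ : _ \o _ = (fun x => (s * n%:R)%:E * (`|G x| `^ p)%:E)%E).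
      exact: integrableZl.
    by apply/funext => x; rewrite /= EFinM.
  have iD2 := @integrable_ball_indic R n (s * n%:R * M `^ p) (2 / s).
  have iD : mu.-integrable setT (EFin \o D).
    rewrite (_ : _ \o _ = (fun x => ((s * n%:R * `|G x| `^ p)%:E +
       (s * n%:R * M `^ p * \1_B x)%:E))%E).
      exact: integrableD.
    by apply/funext => x; rewrite /= EFinD.
  have wD x : \sum_i enorm (g x) `^ (p - 1) * `|w x ord0 i| <= D x.
    apply: (@le_trans _ _ (\sum_(i < n) s * (`|G x| `^ p + M `^ p * \1_B x))).
      apply: ler_sum => i _; rewrite wE normrM gtr0_norm// mulrCA ler_wpM2l ?(ltW s0)//.
      rewrite [ `|G x| ]ger0_norm ?enorm_ge0// indicE.
      have [xs|xs] := ltP `|x| (2 / s).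
        rewrite mem_set//= mulr1.
        apply: (le_trans (young_powR1 p1 (enorm_ge0 _) (normr_ge0 _))).
        by rewrite lerD2l; apply: ge0_ler_powR; rewrite ?nnegrE ?(ltW p0).
      rewrite (@partial_support _ _ _ 1 i (@bump_support R n)).
        by rewrite normr0 mulr0 addr_ge0 ?mulr_ge0 ?powR_ge0.
      rewrite normrZ gtr0_norm//; rewrite ler_pdivrMr// in xs.
      by rewrite mulrC (lt_le_trans _ xs)// ltr1n.
    rewrite sumr_const card_ord -mulr_natl /D le_eqVlt; apply/orP; left; apply/eqP.
    by ring.
  have := Rintegral_flux_dot_le p1 mg mw iD wD.
  have := tc _ (test_scaled_bump s0); rewrite /p_energy_form /flux_dot => ->.
  rewrite normrM normrN.
  rewrite (gtr0_norm (Rintegral_scaled_bump_gt0 s0)).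
  rewrite /D RintegralD// RintegralZl// Rintegral_ball_indic ?divr_gt0//.
  rewrite -/E => h.
  have h2 := Rintegral_scaled_bump_ge s0 (n := n).
  have : `|c| * (k0 * s^-1 ^+ n) <= s * n%:R * E + s * n%:R * M `^ p * (2 * (2 / s)) ^+ n.
    by apply: le_trans h; rewrite ler_wpM2l.
  have e1 : `|c| * (k0 * s^-1 ^+ n) * s ^+ n = `|c| * k0.
    by rewrite -!mulrA -exprMn mulVf ?lt0r_neq0// expr1n mulr1.
  rewrite -(ler_pM2r sn0) e1.
  move=> /le_trans; apply; rewrite mulrDl.
  have e2 : (2 * (2 / s)) ^+ n * s ^+ n = 4 ^+ n.
    rewrite -exprMn -!mulrA mulVf ?lt0r_neq0// mulr1.
    by congr (_ ^+ n); ring.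
  rewrite -[X in _ + X]mulrA e2.
  rewrite /K mulrDr; apply: lerD; last by rewrite !mulrA.
  rewrite mulrA -[leRHS]mulr1 ler_wpM2l ?exprn_ile1 ?(ltW s0)//.
  by rewrite !mulr_ge0 ?(ltW s0).
apply/eqP; rewrite -normr_eq0 -[_ == 0](@mulIr_eq0 _ k0); last first.
  by apply/rregP; rewrite lt0r_neq0.
apply/eqP/le_anti; rewrite mulr_ge0 ?(ltW k00)// andbT.
apply/ler_addgt0Pl => e e0; rewrite addr0.
have K1 : 0 < K + 1 by rewrite ltr_wpDl.
apply: (@le_trans _ _ (Num.min 1 (e / (K + 1)) * K)).
  by apply: key; [rewrite lt_min ltr01 divr_gt0|rewrite ge_min lexx].
apply: (@le_trans _ _ (e / (K + 1) * K)).
  by rewrite ler_wpM2r// ge_min lexx orbT.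
by rewrite mulrAC ler_pdivrMr// ler_wpM2l ?(ltW e0)// lerDl.
Qed.

End tension.

(** * The regularised energy *)

Section kernel_bounds.
Context {R : realType} {n : nat} (p : R) (p1 : 1 < p).
Local Notation mu := (lebesgue_rV n).
Local Notation T := 'rV[R]_n.
Variable Phi : T -> R.
Hypothesis cPhi : continuous Phi.
Hypothesis Phi0 : forall z, 0 <= Phi z.
Hypothesis iPhi : mu.-integrable setT (EFin \o Phi).

Let mPhi : measurable_fun setT Phi. Proof. exact: continuous_measurable_rV. Qed.

Lemma measurable_kernel (q : T * T -> R) : measurable_fun setT q ->
  measurable_fun setT (fun xz : T * T => (q xz * Phi xz.2)%:E).
Proof.
move=> mq; apply/measurable_EFinP; apply: measurable_funM => //.
exact: (measurableT_comp mPhi measurable_snd).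
Qed.

(** Integrating in x first, only the translations z charged by the kernel count;
    this is where smallness for small z enters. *)
Lemma kernel_tonelli (q : T * T -> R) (K : R) : measurable_fun setT q ->
  (forall xz, 0 <= q xz) ->
  (forall z, Phi z != 0 -> (\int[mu]_x (q (x, z))%:E <= K%:E)%E) ->
  (\int[mu]_x \int[mu]_z (q (x, z) * Phi z)%:E <=
    (K * \int[mu]_z Phi z)%:E)%E.
Proof.
move=> mq q0 qK.
rewrite (@fubini_tonelli _ _ T T R mu mu (fun xz => (q xz * Phi xz.2)%:E)); last 2 first.
- exact: measurable_kernel.
- by move=> xz; rewrite lee_fin mulr_ge0.
have mqz z : measurable_fun setT (fun x => q (x, z)).
  exact: (measurableT_comp mq (pair2_measurable z)).
apply: (@le_trans _ _ (\int[mu]_z (K%:E * (Phi z)%:E))%E); last first.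
  rewrite (@integralZl _ _ _ mu setT measurableT _ iPhi K).
  by rewrite EFinM /Rintegral fineK//; exact: (integrable_fin_num measurableT iPhi).
apply: ge0_le_integral => //.
- by move=> z _; apply: integral_ge0 => x _; rewrite lee_fin mulr_ge0.
- apply: (@measurable_fun_fubini_tonelli_G _ _ T T R mu (fun xz => (q xz * Phi xz.2)%:E)).
    exact: measurable_kernel.
  by move=> xz; rewrite lee_fin mulr_ge0.
- by apply: measurable_funeM; exact/measurable_EFinP.
move=> z _ /=.
rewrite (eq_integral (fun x => (Phi z)%:E * (q (x, z))%:E)%E); last first.
  by move=> x _; rewrite EFinM muleC.
rewrite ge0_integralZl_EFin//; last 2 first.
- by move=> x _; rewrite lee_fin.
- exact/measurable_EFinP.
have [->|Pz] := eqVneq (Phi z) 0; first by rewrite mul0e mule0.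
by rewrite muleC lee_wpmul2r ?lee_fin// qK.
Qed.

Variable g : T -> T.
Hypothesis mg : forall i, measurable_fun setT (fun x => g x ord0 i).
Local Notation G := (fun x => enorm (g x)).

(** Young's inequality under the kernel, integrated with Tonelli's theorem. *)
Lemma flux_kernel_le (k : T * T -> R) (d K : R) : 0 < d ->
  measurable_fun setT k ->
  measurable_fun setT (fun x => \int[mu]_z (k (x, z) * Phi z)) ->
  (forall z, Phi z != 0 -> (\int[mu]_x
     (d * G x `^ p + (d `^ (p - 1))^-1 * `|k (x, z)| `^ p)%:E <= K%:E)%E) ->
  (\int[mu]_x (G x `^ (p - 1) * `|\int[mu]_z (k (x, z) * Phi z)|)%:E <=
     (K * \int[mu]_z Phi z)%:E)%E.
Proof.
move=> d0 mk mw hK.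
have mG : measurable_fun setT G := measurable_enorm mg.
pose q (xz : T * T) := d * G xz.1 `^ p + (d `^ (p - 1))^-1 * `|k xz| `^ p.
have mq : measurable_fun setT q.
  apply: measurable_funD; apply: measurable_funM => //.
    apply: (measurableT_comp (measurable_powR _)).
    exact: (measurableT_comp mG measurable_fst).
  apply: (measurableT_comp (measurable_powR _)).
  exact: (measurableT_comp (@normr_measurable R setT) mk).
have q0 xz : 0 <= q xz.
  by rewrite addr_ge0 ?mulr_ge0 ?invr_ge0 ?powR_ge0// ltW.
apply: le_trans (kernel_tonelli mq q0 hK).
apply: ge0_le_integral => //.
- by move=> x _; rewrite lee_fin mulr_ge0 ?powR_ge0.
- apply/measurable_EFinP; apply: measurable_funM.
    exact: (measurableT_comp (measurable_powR _) mG).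
  exact: (measurableT_comp (@normr_measurable R setT) mw).
- apply: (@measurable_fun_fubini_tonelli_F _ _ T T R mu (fun xz => (q xz * Phi xz.2)%:E)).
    exact: measurable_kernel.
  by move=> xz; rewrite lee_fin mulr_ge0.
move=> x _.
have mkx : measurable_fun setT (fun z => k (x, z)).
  exact: (measurableT_comp mk (pair1_measurable x)).
have mkP : measurable_fun setT (fun z => k (x, z) * Phi z) by exact: measurable_funM.
have h1 : ((`|\int[mu]_z (k (x, z) * Phi z)|)%:E <=
    \int[mu]_z (`|k (x, z)| * Phi z)%:E)%E.
  have mkPE : measurable_fun setT (EFin \o (fun z => k (x, z) * Phi z)).
    exact/measurable_EFinP.
  apply: (le_trans _ (le_trans (le_abse_integral mu measurableT mkPE) _)).
    by rewrite /Rintegral; case: (\int[mu]_z _)%E => [r| |] //=; rewrite ?leey.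
  rewrite le_eqVlt; apply/orP; left; apply/eqP.
  by apply: eq_integral => z _; rewrite /= normrM (ger0_norm (Phi0 z)).
rewrite EFinM; apply: (le_trans (lee_wpmul2l _ h1)).
  by rewrite lee_fin powR_ge0.
rewrite -ge0_integralZl_EFin ?powR_ge0//; last 2 first.
- by move=> z _; rewrite lee_fin mulr_ge0.
- apply/measurable_EFinP; apply: measurable_funM => //.
  exact: (measurableT_comp (@normr_measurable R setT) mkx).
apply: ge0_le_integral => //.
- by move=> z _; rewrite mule_ge0 ?lee_fin ?mulr_ge0 ?powR_ge0.
- apply: measurable_funeM; apply/measurable_EFinP; apply: measurable_funM => //.
  exact: (measurableT_comp (@normr_measurable R setT) mkx).
- apply/measurable_EFinP; apply: measurable_funM => //.
  exact: (measurableT_comp mq (pair1_measurable x)).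
move=> z _; rewrite -EFinM lee_fin mulrA ler_wpM2r//.
by apply: young_powR; rewrite ?enorm_ge0.
Qed.

Hypothesis goo : forall i, (pmass p (fun x => g x ord0 i) < +oo)%E.

Lemma measurable_shift (h : T -> R) : measurable_fun setT h ->
  measurable_fun setT (fun xz : T * T => h (xz.1 + xz.2)).
Proof. by move=> mh; exact: (measurableT_comp mh (@measurable_addr_rV R n)). Qed.

Lemma pmass_fineK (h : T -> R) :
  (pmass p h < +oo)%E -> pmass p h = (fine (pmass p h))%:E.
Proof.
move=> hoo; rewrite fineK// ge0_fin_numE//.
by apply: integral_ge0 => x _; rewrite lee_fin powR_ge0.
Qed.

(** The case d = 1 of the previous estimate; translation invariance bounds the
    inner integral uniformly in z. *)
Lemma integrable_flux_shift (h : T -> R) : measurable_fun setT h ->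
  (pmass p h < +oo)%E ->
  measurable_fun setT (fun x : T => \int[mu]_z (h (x + z) * Phi z)) ->
  mu.-integrable setT (EFin \o
    (fun x : T => G x `^ (p - 1) * `|\int[mu]_z (h (x + z) * Phi z)|)).
Proof.
move=> mh hoo mw.
have mG : measurable_fun setT G := measurable_enorm mg.
have Goo := pmass_enorm_lty p1 mg goo.
apply/integrableP; split.
  apply/measurable_EFinP; apply: measurable_funM.
    exact: (measurableT_comp (measurable_powR _) mG).
  exact: (measurableT_comp (@normr_measurable R setT) mw).
rewrite (eq_integral (fun x : T =>
    (G x `^ (p - 1) * `|\int[mu]_z (h (x + z) * Phi z)|)%:E)); last first.
  by move=> x _; rewrite gee0_abs//= lee_fin mulr_ge0 ?powR_ge0.
apply: (@le_lt_trans _ _ ((fine (pmass p G) + fine (pmass p h)) *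
  \int[mu]_z Phi z)%:E); last by rewrite ltry.
apply: (@flux_kernel_le (fun xz => h (xz.1 + xz.2)) 1) => //.
  exact: measurable_shift.
move=> z _ /=; rewrite powR1 invr1.
rewrite (eq_integral (fun x : T => (`|G x| `^ p)%:E + (`|h (x + z)%R| `^ p)%:E)%E); last first.
  by move=> x _; rewrite !mul1r EFinD (ger0_norm (enorm_ge0 _)).
rewrite ge0_integralD//; last 2 first.
- exact: (measurable_pmass p mG).
- exact: (measurable_pmass p (measurable_fun_translate z mh)).
rewrite EFinD -!pmass_fineK// -[in leRHS](pmass_translate p z mh).
exact: lexx.
Qed.

End kernel_bounds.

Section cutoff.
Context {R : realType} {n : nat} (p : R) (p1 : 1 < p).
Local Notation mu := (lebesgue_rV n).
Local Notation T := 'rV[R]_n.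
Let p0 : 0 < p. Proof. exact: lt_trans p1. Qed.

Lemma flux_dotDZ (v w1 w2 : T) (a b : R) :
  flux_dot p v (a *: w1 + b *: w2) = a * flux_dot p v w1 + b * flux_dot p v w2.
Proof.
rewrite /flux_dot /dot !(mulrCA _ (enorm v `^ _)) -mulrDr; congr (_ * _).
by rewrite !mulr_sumr -big_split/=; apply: eq_bigr => i _; rewrite !mxE; ring.
Qed.

Variables (f : T -> R) (g : T -> T).
Hypothesis cf : continuous f.
Hypothesis wg : is_weak_gradient f g.
Hypothesis mg : forall i, measurable_fun setT (fun x => g x ord0 i).
Hypothesis foo : (pmass p f < +oo)%E.
Hypothesis goo : forall i, (pmass p (fun x => g x ord0 i) < +oo)%E.
Hypothesis hE : forall psi, test_function psi ->
  \int[mu]_x flux_dot p (g x) (nabla psi x) = 0.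

Variable s : R.
Hypothesis s0 : 0 < s.
Local Notation Phi := (@scaled_bump R n s).
Local Notation G := (fun x => enorm (g x)).

Let cPhi : continuous Phi.
Proof. exact: (smooth_continuous (smooth_scaled_bump s)). Qed.

Let mPhi : measurable_fun setT Phi. Proof. exact: continuous_measurable_rV. Qed.

Let mf : measurable_fun setT f. Proof. exact: continuous_measurable_rV. Qed.

Let sPhi : forall z : T, s^-1 < `|z| -> Phi z = 0.
Proof. by move=> z; exact: scaled_bump_support. Qed.

Definition reg_grad (x : T) : T := \row_i correlation (fun y => g y ord0 i) Phi x.

Lemma partial_reg i x : partial i (correlation f Phi) x = reg_grad x ord0 i.
Proof.
by rewrite mxE; exact: (partial_correlation i x cf wg (smooth_scaled_bump s) sPhi).
Qed.

Lemma smooth_reg : smooth (correlation f Phi).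
Proof. exact: (smooth_correlation cf (smooth_scaled_bump s) sPhi). Qed.

Lemma measurable_reg_grad i : measurable_fun setT (fun x => reg_grad x ord0 i).
Proof.
rewrite (_ : (fun x => _) = partial i (correlation f Phi)).
  exact: (continuous_measurable_rV (smooth_continuous (smooth_partial i smooth_reg))).
by apply/funext => x; rewrite partial_reg.
Qed.

Lemma integrable_flux_correlation (h : T -> R) : measurable_fun setT h ->
  (pmass p h < +oo)%E -> measurable_fun setT (correlation h Phi) ->
  mu.-integrable setT (EFin \o (fun x => G x `^ (p - 1) * `|correlation h Phi x|)).
Proof.
move=> mh hoo mc.
have E (x : T) : correlation h Phi x = \int[mu]_z (h (x + z) * Phi z).
  by rewrite correlationE.
have E1 : correlation h Phi = (fun x : T => \int[mu]_z (h (x + z) * Phi z)).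
  by apply/funext => x; exact: E.
rewrite E1 in mc *.
exact: (integrable_flux_shift p1 cPhi (@scaled_bump_ge0 R n s)
  (integrable_scaled_bump s0) mg goo mh hoo mc).
Qed.

Lemma measurable_correlation_grad i :
  measurable_fun setT (correlation (fun y => g y ord0 i) Phi).
Proof.
rewrite (_ : correlation _ _ = (fun x => reg_grad x ord0 i)).
  exact: measurable_reg_grad.
by apply/funext => x; rewrite mxE.
Qed.

Let iv i : mu.-integrable setT (EFin \o (fun x => G x `^ (p - 1) * `|reg_grad x ord0 i|)).
Proof.
have E : (fun x => G x `^ (p - 1) * `|reg_grad x ord0 i|) =
    (fun x => G x `^ (p - 1) * `|correlation (fun y => g y ord0 i) Phi x|).
  by apply/funext => x; rewrite mxE.
rewrite E.
exact: (integrable_flux_correlation (mg i) (goo i) (measurable_correlation_grad i)).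
Qed.

Lemma integrable_flux_reg :
  mu.-integrable setT (EFin \o (fun x => flux_dot p (g x) (reg_grad x))).
Proof.
apply: (integrable_flux_dot p1 mg measurable_reg_grad
  (D := fun x => \sum_i G x `^ (p - 1) * `|reg_grad x ord0 i|)) => //.
rewrite (_ : _ \o _ = (fun x => \sum_(i < n) (G x `^ (p - 1) * `|reg_grad x ord0 i|)%:E)%E).
  exact: (integrable_sum measurableT (index_enum 'I_n) (fun i _ => iv i)).
by apply/funext => x /=; rewrite sumEFin.
Qed.

(** The cut-off argument: as the dilation parameter t tends to 0, the cut-off
    scaled_bump t tends to a positive constant, while the term in which the
    derivative falls on the cut-off carries a factor t. The dominating function
    exists because f, and not only its gradient, lies in L^p. *)
Lemma Rintegral_flux_reg_eq0 : \int[mu]_x flux_dot p (g x) (reg_grad x) = 0.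
Proof.
set u := correlation f Phi.
have su : smooth u := smooth_reg.
have [M M0 hM] := @partial_bump_bound R n.
pose t (k : nat) : R := k.+1%:R^-1.
have t0 k : 0 < t k by rewrite invr_gt0 ltr0n.
have t1 k : t k <= 1 by rewrite invf_le1 ?ltr0n// ler1n.
pose psi k (x : T) := scaled_bump (t k) x * u x.
have spsi k : smooth (psi k) by apply: smoothM => //; exact: smooth_scaled_bump.
have tpsi k : test_function (psi k).
  apply: (@smooth_test_function _ _ _ (t k)^-1) => // x xk.
  by rewrite /psi scaled_bump_support// mul0r.
have npsi k x : nabla (psi k) x =
    scaled_bump (t k) x *: reg_grad x + (t k * u x) *: nabla bump_rV (t k *: x).
  apply/rowP => i; rewrite [LHS]mxE.
  have h : partial i (psi k) x = scaled_bump (t k) x * partial i u x +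
      u x * partial i (scaled_bump (t k)) x.
    by have [_] := partialM i x (smooth_scaled_bump (t k)) su.
  rewrite h partial_reg partial_scaled_bump [RHS]mxE; congr (_ + _).
    by rewrite [RHS]mxE.
  by rewrite !mxE; ring.
pose A x := flux_dot p (g x) (reg_grad x).
pose F k x := flux_dot p (g x) (nabla (psi k) x).
have FE k x : F k x = scaled_bump (t k) x * A x +
    t k * u x * flux_dot p (g x) (nabla bump_rV (t k *: x)).
  by rewrite /F npsi flux_dotDZ.
pose H x := \sum_(i < n) G x `^ (p - 1) * `|reg_grad x ord0 i|.
pose D x := H x + \sum_(i < n) M * (G x `^ (p - 1) * `|u x|).
have iu : mu.-integrable setT (EFin \o (fun x => G x `^ (p - 1) * `|u x|)).
  apply: (integrable_flux_correlation mf foo).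
  exact: (continuous_measurable_rV (smooth_continuous su)).
have iH : mu.-integrable setT (EFin \o H).
  rewrite (_ : _ \o _ = (fun x => \sum_(i < n) (G x `^ (p - 1) * `|reg_grad x ord0 i|)%:E)%E).
    exact: (integrable_sum measurableT (index_enum 'I_n) (fun i _ => iv i)).
  by apply/funext => x /=; rewrite sumEFin.
have iD : mu.-integrable setT (EFin \o D).
  rewrite (_ : _ \o _ = (fun x => (EFin \o H) x +
      \sum_(i < n) (M%:E * (G x `^ (p - 1) * `|u x|)%:E))%E).
    apply: integrableD => //.
    apply: (integrable_sum measurableT (index_enum 'I_n)) => i _.
    exact: (integrableZl measurableT M iu).
  apply/funext => x /=; rewrite /D EFinD; congr (_ + _)%E.
  by rewrite sumEFin; congr EFin; apply: eq_bigr => i _.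
have flux_u k x : `|u x * flux_dot p (g x) (nabla bump_rV (t k *: x))| <=
    \sum_(i < n) M * (G x `^ (p - 1) * `|u x|).
  rewrite normrM (le_trans (ler_wpM2l (normr_ge0 _) (flux_dot_le p1 _ _)))//.
  rewrite mulr_sumr; apply: ler_sum => i _.
  rewrite mxE mulrCA [leRHS]mulrCA ler_wpM2l ?powR_ge0// mulrC.
  by rewrite ler_wpM2r.
have FD k x : `|F k x| <= D x.
  rewrite FE (le_trans (ler_normD _ _))// /D; apply: lerD.
    rewrite normrM ger0_norm ?scaled_bump_ge0// -[leRHS]mul1r.
    by rewrite ler_pM ?scaled_bump_ge0 ?bump_le1//; exact: flux_dot_le.
  rewrite -mulrA normrM gtr0_norm// -[leRHS]mul1r.
  by rewrite ler_pM// ?(ltW (t0 k)).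
have mFk k : measurable_fun setT (F k).
  apply: (measurable_flux_dot p mg) => i.
  rewrite (_ : (fun x => _) = partial i (psi k)).
    exact: (continuous_measurable_rV (smooth_continuous (smooth_partial i (spsi k)))).
  by apply/funext => x; rewrite mxE.
have iF k : mu.-integrable setT (EFin \o F k).
  apply: (le_integrable measurableT _ _ iD); first exact/measurable_EFinP.
  by move=> x _ /=; rewrite lee_fin (le_trans (FD k x))// ler_norm.
have t_cvg : t k @[k --> \oo] --> (0 : R).
  apply/cvgrPdist_lt => e e0; near=> k.
  rewrite sub0r normrN gtr0_norm//; near: k.
  exact: near_infty_natSinv_lt (PosNum e0).
have F_cvg x : F k x @[k --> \oo] --> bump_rV (0 : T) * A x.
  rewrite (_ : (fun k => F k x) = (fun k => scaled_bump (t k) x * A x) +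
    (fun k => t k * (u x * flux_dot p (g x) (nabla bump_rV (t k *: x)))))%R; last first.
    by apply/funext => k; rewrite FE !fctE mulrA.
  rewrite -[X in _ --> X]addr0; apply: cvgD.
    apply: cvgM; last exact: cvg_cst.
    have h1 : bump_rV (r *: x) @[r --> (0 : R)] --> bump_rV ((0 : R) *: x).
      have cb := smooth_continuous (@smooth_bump R n).
      have cs : continuous (fun r : R => r *: x) := @scalel_continuous R T x.
      have h := continuous_comp (cs 0) (cb ((0 : R) *: x)).
      exact: h.
    rewrite scale0r in h1.
    have h2 := cvg_comp _ _ t_cvg h1.
    exact: h2.
  pose C := \sum_(i < n) M * (G x `^ (p - 1) * `|u x|).
  apply/norm_cvg0P; apply: (@squeeze_cvgr _ _ _ _ (cst 0) (fun k => t k * C)).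
  - near=> k; rewrite normr_ge0/= normrM gtr0_norm// ler_wpM2l// ltW//.
  - exact: cvg_cst.
  - rewrite -[X in _ --> X](mul0r C); apply: cvgM => //; exact: cvg_cst.
have mA : measurable_fun setT A by exact: (measurable_flux_dot p mg measurable_reg_grad).
have intF0 : (fun k => (\int[mu]_x (F k x)%:E)%E) = cst 0%E.
  apply/funext => k; rewrite -[LHS]fineK; last exact: (integrable_fin_num measurableT (iF k)).
  by congr EFin; exact: (hE (tpsi k)).
have lim : (\int[mu]_x (F k x)%:E)%E @[k --> \oo] -->
    (\int[mu]_x (bump_rV (0 : T) * A x)%:E)%E.
  apply: (@dominated_cvg _ T R mu setT measurableT (fun k x => (F k x)%:E)
    (fun x => (bump_rV (0 : T) * A x)%:E) (fun x => (D x)%:E)).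
  - by move=> k; apply/measurable_EFinP.
  - by move=> x _; apply: cvg_EFin; [exact: nearW|exact: F_cvg].
  - by [].
  - exact: iD.
  - by move=> k x _; rewrite lee_fin.
have H1 : (\int[mu]_x (bump_rV (0 : T) * A x)%:E)%E = 0%E.
  by rewrite intF0 in lim; apply: (cvg_unique _ lim (cvg_cst (0%E : \bar R))).
have b0 : 0 < bump_rV (0 : T).
  apply: lt_le_trans (bump_half _); first by rewrite exprn_gt0 ?expR_gt0.
  by rewrite normr0 invr_gt0.
apply: (mulfI (lt0r_neq0 b0)); rewrite mulr0.
rewrite -RintegralZl//; last exact: integrable_flux_reg.
by rewrite /Rintegral H1.
Unshelve. all: by end_near. Qed.

End cutoff.

Section energy.
Context {R : realType} {n : nat} (p : R) (p1 : 1 < p).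
Local Notation mu := (lebesgue_rV n).
Local Notation T := 'rV[R]_n.
Let p0 : 0 < p. Proof. exact: lt_trans p1. Qed.

Variables (f : T -> R) (g : T -> T).
Hypothesis cf : continuous f.
Hypothesis wg : is_weak_gradient f g.
Hypothesis mg : forall i, measurable_fun setT (fun x => g x ord0 i).
Hypothesis foo : (pmass p f < +oo)%E.
Hypothesis goo : forall i, (pmass p (fun x => g x ord0 i) < +oo)%E.
Hypothesis hE : forall psi, test_function psi ->
  \int[mu]_x flux_dot p (g x) (nabla psi x) = 0.

Local Notation G := (fun x => enorm (g x)).

Lemma integrable_shift_bump (h : T -> R) (s : R) (x : T) : 0 < s ->
  measurable_fun setT h -> (pmass p h < +oo)%E ->
  mu.-integrable setT (EFin \o (fun z : T => h (x + z) * scaled_bump s z)).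
Proof.
move=> s0 mh hoo.
have E : (fun z : T => h (x + z)) = (fun z : T => h (z + x)).
  by apply/funext => z; rewrite addrC.
have mhx : measurable_fun setT (fun z : T => h (x + z)).
  by rewrite E; exact: (measurable_fun_translate x mh).
have ih : mu.-integrable setT (fun z : T => (`|h (x + z)| `^ p)%:E).
  by apply: (pmass_lty_integrable (p := p) mhx); rewrite E (pmass_translate p x mh).
have ib := integrable_scaled_bump s0 (n := n).
have mb : measurable_fun setT (@scaled_bump R n s).
  exact: (continuous_measurable_rV (smooth_continuous (smooth_scaled_bump s))).
apply: (le_integrable measurableT _ _ (integrableD measurableT ib ih)).
  by apply/measurable_EFinP; exact: measurable_funM.
move=> z _ /=; rewrite lee_fin [leRHS]ger0_norm; last first.
  by rewrite addr_ge0 ?scaled_bump_ge0 ?powR_ge0.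
have b0 := scaled_bump_ge0 s z; have b1 : scaled_bump s z <= 1 := bump_le1 _.
rewrite normrM (ger0_norm b0).
apply: (@le_trans _ _ ((1 + `|h (x + z)| `^ p) * scaled_bump s z)).
  by rewrite ler_wpM2r// le_1DpowR.
by rewrite mulrDl mul1r lerD2l -[leRHS]mulr1 ler_wpM2l ?powR_ge0.
Qed.

Let mG : measurable_fun setT G. Proof. exact: measurable_enorm. Qed.
Let Goo : (pmass p G < +oo)%E. Proof. exact: pmass_enorm_lty. Qed.
Let E : R := fine (pmass p G).

(** With J the integral of the kernel and v the regularised gradient, J E is the
    integral of the flux against J g, hence against w = J g - v since the flux is
    orthogonal to v; and w x is the integral of (g x - g (x + z)) Phi z, which is
    small in L^p for a concentrated kernel. *)
Lemma energy_le (d e : R) : 0 < d -> 0 < e ->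
  E <= n%:R * (d * E + (d `^ (p - 1))^-1 * e).
Proof.
move=> d0 e0; set K := d * E + _.
have H (i : 'I_n) : exists r : R, 0 < r /\ forall z : T, `|z| < r ->
    (pmass p (fun x : T => g (x + z) ord0 i - g x ord0 i)%R <= e%:E)%E.
  have [_ /(_ e e0)[r r0 h]] := translation_continuity p0 (mg i) (goo i).
  by exists r; split.
have [r hr] := choice H.
(* this s exceeds every 1 / r i, so the kernel charges only translations of
   length less than every r i *)
pose s := 1 + \sum_i (r i)^-1.
have ri0 i : 0 < r i by have [] := hr i.
have s0 : 0 < s by rewrite ltr_pwDl// sumr_ge0// => i _; rewrite invr_ge0 ltW.
have sr i : s^-1 < r i.
  rewrite invf_plt ?posrE// /s (bigD1 i)//= addrCA ltrDl ltr_pwDl//.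
  by rewrite sumr_ge0// => j _; rewrite invr_ge0 ltW.
set Phi := @scaled_bump R n s.
have cPhi : continuous Phi := smooth_continuous (smooth_scaled_bump s).
have Phi0 z : 0 <= Phi z := scaled_bump_ge0 s z.
have iPhi := integrable_scaled_bump s0 (n := n).
pose J := \int[mu]_z Phi z.
have J0 : 0 < J := Rintegral_scaled_bump_gt0 s0.
pose v := reg_grad g s.
have mv i : measurable_fun setT (fun x => v x ord0 i) :=
  measurable_reg_grad cf wg s0 i.
pose w (x : T) : T := J *: g x - v x.
have wE i x : w x ord0 i = \int[mu]_z ((g x ord0 i - g (x + z) ord0 i) * Phi z).
  rewrite /w !mxE correlationE//; last exact: continuous_measurable_rV.
  rewrite mulrC -RintegralZl// -RintegralB//.
  - by apply: eq_Rintegral => z _; rewrite mulrBl.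
  - rewrite (_ : _ \o _ = (fun z => (g x ord0 i)%:E * (Phi z)%:E)%E).
      exact: integrableZl.
    by apply/funext => z; rewrite /= EFinM.
  - exact: (integrable_shift_bump x s0 (mg i) (goo i)).
have mw i : measurable_fun setT (fun x => w x ord0 i).
  rewrite (_ : (fun x => _) = (fun x => J * g x ord0 i - v x ord0 i)).
    by apply: measurable_funB => //; exact: measurable_funM.
  by apply/funext => x; rewrite !mxE.
pose D i x := G x `^ (p - 1) * `|w x ord0 i|.
have D0 i x : 0 <= D i x by rewrite mulr_ge0 ?powR_ge0.
have mD i : measurable_fun setT (D i).
  apply: measurable_funM.
    exact: (measurableT_comp (measurable_powR _) mG).
  exact: (measurableT_comp (@normr_measurable R setT) (mw i)).
have D_le i : (\int[mu]_x (D i x)%:E <= (K * J)%:E)%E.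
  have Ew : (fun x => w x ord0 i) =
      (fun x => \int[mu]_z ((g x ord0 i - g (x + z) ord0 i) * Phi z)).
    by apply/funext => x; exact: wE.
  rewrite (eq_integral (fun x => (G x `^ (p - 1) *
      `|\int[mu]_z ((g x ord0 i - g (x + z) ord0 i) * Phi z)|)%:E)); last first.
    by move=> x _; rewrite /D wE.
  apply: (@flux_kernel_le R n p p1 Phi cPhi Phi0 iPhi g mg
    (fun xz => g xz.1 ord0 i - g (xz.1 + xz.2) ord0 i) d K d0).
  - apply: measurable_funB.
      exact: (measurableT_comp (mg i) measurable_fst).
    exact: (measurable_shift (mg i)).
  - by rewrite /= -Ew.
  - move=> z Pz /=.
    have zr : `|z| < r i.
      rewrite (le_lt_trans _ (sr i))// leNgt; apply/negP => sz.
      by move: Pz; rewrite /Phi scaled_bump_support ?eqxx.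
    have mgz := measurable_fun_translate z (mg i).
    pose q x := g (x + z) ord0 i - g x ord0 i.
    have mq : measurable_fun setT q by exact: measurable_funB.
    rewrite (eq_integral (fun x => d%:E * (`|G x| `^ p)%:E +
        ((d `^ (p - 1))^-1)%:E * (`|q x| `^ p)%:E)%E); last first.
      by move=> x _; rewrite EFinD !EFinM (ger0_norm (enorm_ge0 _)) distrC.
    rewrite ge0_integralD//; last 4 first.
    - by move=> x _; rewrite mule_ge0// lee_fin ?powR_ge0// ltW.
    - by apply: measurable_funeM; exact: (measurable_pmass p mG).
    - by move=> x _; rewrite mule_ge0// lee_fin ?invr_ge0 ?powR_ge0.
    - by apply: measurable_funeM; exact: (measurable_pmass p mq).
    rewrite ge0_integralZl_EFin ?(ltW d0)//; last exact: (measurable_pmass p mG).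
    rewrite ge0_integralZl_EFin ?invr_ge0 ?powR_ge0//; last exact: (measurable_pmass p mq).
    rewrite /K EFinD !EFinM; apply: leeD.
      by rewrite /E -(pmass_fineK Goo).
    by apply: lee_wpmul2l; rewrite ?lee_fin ?invr_ge0 ?powR_ge0//; apply: (hr i).2.
have iD i : mu.-integrable setT (EFin \o D i).
  apply/integrableP; split; first exact/measurable_EFinP.
  rewrite (eq_integral (fun x => (D i x)%:E)); last first.
    by move=> x _; rewrite gee0_abs//= lee_fin.
  by rewrite (le_lt_trans (D_le i))// ltry.
pose DD x := \sum_i D i x.
have iDD : mu.-integrable setT (EFin \o DD).
  rewrite (_ : _ \o _ = (fun x => \sum_(i < n) (D i x)%:E)%E).
    exact: (integrable_sum measurableT (index_enum 'I_n) (fun i _ => iD i)).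
  by apply/funext => x /=; rewrite sumEFin.
have DD_le : \int[mu]_x DD x <= n%:R * (K * J).
  rewrite -lee_fin /Rintegral fineK; last exact: (integrable_fin_num measurableT iDD).
  rewrite (eq_integral (fun x => \sum_(i < n) (D i x)%:E)%E); last first.
    by move=> x _; rewrite /= sumEFin.
  rewrite ge0_integral_sum//; last 2 first.
  - by move=> i; apply/measurable_EFinP.
  - by move=> i x _; rewrite lee_fin.
  apply: (@le_trans _ _ (\sum_(i < n) (K * J)%:E)%E); first exact: lee_sum.
  by rewrite sumEFin lee_fin sumr_const card_ord mulr_natl.
have iw := integrable_flux_dot p1 mg mw iDD (fun x => lexx _).
have iv := integrable_flux_reg p1 cf wg mg goo s0.
have sum_eq x : flux_dot p (g x) (v x) + flux_dot p (g x) (w x) = J * G x `^ p.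
  have := flux_dotDZ p (g x) (v x) (w x) 1 1; rewrite !scale1r !mul1r => <-.
  rewrite /w addrC subrK.
  have := flux_dotDZ p (g x) (g x) 0 J 0.
  by rewrite scaler0 addr0 mul0r addr0 flux_dot_self.
have iG : mu.-integrable setT (fun x => (G x `^ p)%:E).
  have := pmass_lty_integrable mG Goo.
  by under eq_fun do rewrite (ger0_norm (enorm_ge0 _)).
have JE : J * E = \int[mu]_x flux_dot p (g x) (w x).
  transitivity (\int[mu]_x (J * G x `^ p)).
    rewrite RintegralZl//; apply: (congr1 ( *%R J)); apply: (congr1 fine).
    by apply: eq_integral => x _; rewrite (ger0_norm (enorm_ge0 _)).
  under eq_Rintegral do rewrite -sum_eq.
  rewrite RintegralD//.
  by rewrite (Rintegral_flux_reg_eq0 p1 cf wg mg foo goo hE s0) add0r.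
have : J * E <= J * (n%:R * K).
  rewrite JE mulrCA [J * K]mulrC (le_trans _ DD_le)// (le_trans (ler_norm _))//.
  exact: (Rintegral_flux_dot_le p1 mg mw iDD (fun x => lexx _)).
by rewrite ler_pM2l.
Qed.

(** The coefficient of E on the right of energy_le is at most 1/2 for the chosen d,
    and then e is arbitrarily small. *)
Lemma energy_eq0 : pmass p G = 0%E.
Proof.
rewrite (pmass_fineK Goo) -/E; congr EFin; apply/le_anti.
have E0 : 0 <= E by rewrite /E fine_ge0// integral_ge0// => x _; rewrite lee_fin powR_ge0.
rewrite E0 andbT.
pose d : R := (2 * n.+1%:R)^-1.
have d0 : 0 < d by rewrite invr_gt0 mulr_gt0// ltr0n.
pose C := (d `^ (p - 1))^-1.
have C0 : 0 < C by rewrite invr_gt0 powR_gt0.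
have n0 : (0 : R) < n.+1%:R by rewrite ltr0n.
apply/ler_addgt0Pl => e e0; rewrite addr0.
pose e' := e / (2 * n.+1%:R * C).
have e'0 : 0 < e' by rewrite divr_gt0// !mulr_gt0.
have h := energy_le d0 e'0; rewrite -/C in h.
have h2 : n%:R * (d * E + C * e') <= n.+1%:R * (d * E + C * e').
  by rewrite ler_wpM2r ?ler_nat// addr_ge0// mulr_ge0// ltW.
have h3 : n.+1%:R * (d * E + C * e') = E / 2 + e / 2.
  rewrite /e' /d; field.
  by rewrite !lt0r_neq0.
have := le_trans h h2; rewrite h3; lra.
Qed.

End energy.

(** * Constancy *)

Section constancy.
Context {R : realType} {n : nat} (p : R) (p1 : 1 < p).
Local Notation mu := (lebesgue_rV n).
Local Notation T := 'rV[R]_n.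
Let p0 : 0 < p. Proof. exact: lt_trans p1. Qed.

(** Move from 0 to x one coordinate at a time. *)
Lemma partial_eq0_constant (u : T -> R) : smooth u ->
  (forall i x, partial i u x = 0) -> forall x y, u x = u y.
Proof.
move=> su du.
have step i (a : R) x : u (a *: delta_mx ord0 i + x) = u x.
  rewrite -[in RHS](add0r x) -[in RHS](scale0r (delta_mx ord0 i : T)).
  apply: (is_derive_0_is_cst (f := fun t : R => u (t *: delta_mx ord0 i + x))) => t.
  by apply: is_derive_line_at; rewrite -(du i (t *: delta_mx ord0 i + x)); exact: smooth_is_derive.
suff h x : u x = u 0 by move=> x y; rewrite h [RHS]h.
rewrite (row_sum_delta x) -[X in u X]addr0.
elim: (index_enum _) => [|i s ih]; first by rewrite big_nil add0r.
by rewrite big_cons -addrA step.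
Qed.

Lemma pmass_eq0_Rintegral (h k : T -> R) : measurable_fun setT h ->
  measurable_fun setT k -> pmass p h = 0%E -> \int[mu]_x (h x * k x) = 0.
Proof.
move=> mh mk h0; have mp := measurable_pmass p mh.
have : ae_eq mu setT (fun x => (`|h x| `^ p)%:E) (cst 0%E).
  apply/(ae_eq_integral_abs mu measurableT mp); rewrite -h0.
  by apply: eq_integral => x _; rewrite gee0_abs// lee_fin powR_ge0.
move=> ae; rewrite /Rintegral (ae_eq_integral (cst 0%E)) ?integral0//.
  by apply/measurable_EFinP; exact: measurable_funM.
apply: filterS ae => x /(_ I) [/powR_eq0_eq0 /eqP]; rewrite normr_eq0 => /eqP hx _.
by rewrite hx mul0r.
Qed.

(** By continuity, the regularisation at x divided by the integral of the kernel
    tends to f x as the kernel concentrates. *)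
Lemma constant_of_regularisations (f : T -> R) : continuous f ->
  (forall s, 0 < s -> forall x y,
     correlation f (scaled_bump s) x = correlation f (scaled_bump s) y) ->
  forall x y, f x = f y.
Proof.
move=> cf fs.
have near_f (x : T) (e : R) : 0 < e -> exists2 r, 0 < r & forall z, `|z| < r ->
    `|f x - f (x + z)| <= e.
  move=> e0; have /nbhs_ballP[r /= r0 hr] := cf x _ (nbhsx_ballx (f x) e e0).
  exists r => // z zr; apply/ltW/hr; rewrite mx_norm_ball /ball_ /=.
  by rewrite opprD addNKr normrN.
have mf : measurable_fun setT f by exact: continuous_measurable_rV.
have close (x : T) (e r s : R) : (forall z, `|z| < r -> `|f x - f (x + z)| <= e) ->
    0 < s -> s^-1 < r ->
    `|f x * (\int[mu]_z scaled_bump s z) - correlation f (scaled_bump s) x| <=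
    e * \int[mu]_z scaled_bump s z.
  move=> hr s0 sr.
  have cb : continuous (@scaled_bump R n s) := smooth_continuous (smooth_scaled_bump s).
  have ib := integrable_scaled_bump s0 (n := n).
  have sb z : s^-1 < `|z : T| -> scaled_bump s z = 0 by exact: scaled_bump_support.
  have ic : mu.-integrable setT (EFin \o (fun z : T => f (x + z) * scaled_bump s z)).
    apply: (@integrable_continuous_support _ _ _ s^-1); last first.
      by move=> z /sb ->; rewrite mulr0.
    have cfx : continuous (fun z : T => f (x + z)).
      have E : (fun z : T => f (x + z)) = (fun z : T => f (z - - x)).
        by apply/funext => z; rewrite opprK addrC.
      by rewrite E; exact: (@continuous_subr R n f (- x) cf).
    by move=> z; have := continuousM (cfx z) (cb z); exact.
  have iZ a : mu.-integrable setT (EFin \o (fun z : T => a * scaled_bump s z)).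
    rewrite (_ : _ \o _ = (fun z => a%:E * (scaled_bump s z)%:E)%E).
      exact: integrableZl.
    by apply/funext => z; rewrite /= EFinM.
  rewrite correlationE//; last exact: continuous_measurable_rV.
  rewrite -RintegralZl// -RintegralB// -RintegralZl//.
  have iB : mu.-integrable setT (EFin \o (fun z : T =>
      f x * scaled_bump s z - f (x + z) * scaled_bump s z)).
    rewrite (_ : _ \o _ = (fun z : T => (f x * scaled_bump s z)%:E -
        (f (x + z) * scaled_bump s z)%:E)%E).
      by apply: integrableB => //; exact: iZ.
    by apply/funext => z; rewrite /= EFinB.
  apply: (le_trans (le_normr_Rintegral measurableT iB)).
  apply: le_Rintegral => //; first exact: (integrable_norm iB).
  move=> z _; rewrite -mulrBl normrM (ger0_norm (scaled_bump_ge0 _ _)).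
  have [zr|rz] := ltP `|z| r; first by rewrite ler_wpM2r ?scaled_bump_ge0 ?hr.
  by rewrite sb ?mulr0//; apply: lt_le_trans rz.
move=> x y; apply/eqP; rewrite -subr_eq0 -normr_le0; apply/ler_addgt0Pl => e e0.
rewrite addr0; have e20 : 0 < e / 2 by rewrite divr_gt0.
have [r1 r10 h1] := near_f x _ e20; have [r2 r20 h2] := near_f y _ e20.
pose s := 1 + r1^-1 + r2^-1.
have s0 : 0 < s by rewrite !addr_gt0// invr_gt0.
have s1 : s^-1 < r1 by rewrite invf_plt ?posrE// /s addrAC ltrDr addr_gt0// invr_gt0.
have s2 : s^-1 < r2 by rewrite invf_plt ?posrE// /s ltrDr addr_gt0// invr_gt0.
have J0 := Rintegral_scaled_bump_gt0 s0 (n := n).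
have := close x _ _ _ h1 s0 s1; have := close y _ _ _ h2 s0 s2.
rewrite (fs _ s0 x y); set J := \int[mu]_z _; set c := correlation _ _ _ => hy hx.
rewrite -(ler_pM2r J0) -/J -[X in _ * X <= _](gtr0_norm J0) -normrM.
rewrite (_ : (f x - f y) * J = (f x * J - c) - (f y * J - c)); last by ring.
rewrite (le_trans (ler_normB _ _))//.
by rewrite [e]splitr mulrDl lerD.
Qed.

End constancy.

Lemma Lfun_pmass_lty (R : realType) (n : nat) (p : R) (h : 'rV[R]_n -> R) : 1 < p ->
  h \in Lfun (lebesgue_rV n) p%:E ->
  measurable_fun setT h /\ (pmass p h < +oo)%E.
Proof.
move=> p1 hL; split.
  exact: (set_mem (sub_Lfun_mfun hL)).
have := Lfun_integrable (ltW p1) hL; move=> /(integrable_lty measurableT).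
exact.
Qed.

Theorem theorem4p2 (R : realType) (n : nat) (p : R) (f : 'rV[R]_n -> R) :
  (0 < n)%N -> n%:R <= p -> 1 < p ->
  sobolev1 p f -> continuous f -> (exists m : R, forall x, m <= f x) ->
  p_subsolution p f -> (exists c : R, p_tension p f c) ->
  exists a : R, forall x, f x = a.
Proof.
move=> _ _ p1 [fL [g' wg'] gL] cf _ _ [c tc].
have wg : is_weak_gradient f (grad f) by apply: xgetPex; exists g'.
have [_ foo] := Lfun_pmass_lty p1 fL.
have mg i := (Lfun_pmass_lty p1 (gL i)).1.
have goo i := (Lfun_pmass_lty p1 (gL i)).2.
have c0 := p_tension_constant_eq0 p1 mg goo tc.
have hE psi : test_function psi ->
    \int[lebesgue_rV n]_x flux_dot p (grad f x) (nabla psi x) = 0.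
  by move=> tpsi; have := tc _ tpsi; rewrite c0 oppr0 mul0r.
have G0 := energy_eq0 p1 cf wg mg foo goo hE.
have g0 i : pmass p (fun x => grad f x ord0 i) = 0%E.
  apply/eqP; rewrite eq_le; apply/andP; split; last first.
    by apply: integral_ge0 => x _; rewrite lee_fin powR_ge0.
  rewrite -G0; apply: (pmass_le p1 (mg i) (measurable_enorm mg)) => x.
  by rewrite [leRHS]ger0_norm ?enorm_ge0 ?coord_le_enorm.
exists (f 0) => x; apply: (constant_of_regularisations cf) => s s0.
have sP : forall z : 'rV[R]_n, s^-1 < `|z| -> scaled_bump s z = 0.
  by move=> z; exact: scaled_bump_support.
apply: partial_eq0_constant; first exact: (smooth_correlation cf (smooth_scaled_bump s) sP).
move=> i y; rewrite (partial_correlation i y cf wg (smooth_scaled_bump s) sP).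
apply: (pmass_eq0_Rintegral (mg i) _ (g0 i)).
apply: (measurable_fun_translate (- y)).
exact: (continuous_measurable_rV (smooth_continuous (smooth_scaled_bump s))).
Qed.
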